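(* Let $P=P^T\in\mathbb{R}^{2n\times 2n}$ be positive definite, let $\lambda_k\ge 0$ for $k\in\{1,\dots,|\mathcal{E}|\}$, let $\Gamma\in\mathbb{R}^{|\mathcal{E}|\times|\mathcal{E}|}$ be a positive definite diagonal matrix, and let $V$ and $R$ be the function and the matrix built from these data as in the context. Let $V_{\max}=\min\{V^*,W^*\}$, where $V^*=\min\{V_{ij}^-,V_{ij}^+\}_{(i,j)\in\mathcal{E}}$ and $W^*=\min\{W_i^-,W_i^+\}_{i\in\mathcal{N}}$. If $R\preceq 0$, then the set $$\mathcal{X}=\{x\in\mathbb{R}^{2n}:\ V(x)\le V_{\max}\}\cap\mathcal{P}$$ is an invariant set (trajectories of $\dot x=Ax-B\phi(Cx)$ starting in $\mathcal{X}$ remain in $\mathcal{X}$ for all $t\ge 0$) contained inside the operational constraints, i.e. $\mathcal{X}\subseteq\mathcal{P}\cap\mathcal{S}$. Moreover, any trajectory of the system $\dot\theta=\omega$, $M\dot\omega+D\omega=p-EY\sin(E^T\theta)$ (equivalently $\dot x=Ax-B\phi(Cx)$) originating inside $\mathcal{X}$ converges to the post-fault equilibrium point $x=0$.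
   Context: Power system model. $\mathcal{N}=\{1,\dots,n\}$ is a set of generators and $\mathcal{E}$ a set of (arbitrarily oriented) transmission lines; in addition there is an infinite bus, used as angle reference: a node whose angle and frequency are identically $0$, to which lines of $\mathcal{E}$ may be attached, and which is not part of the state. The graph formed by all nodes and lines is connected. $E\in\mathbb{R}^{n\times|\mathcal{E}|}$ is the incidence matrix with the row of the infinite bus removed, so that $E^T\theta$ is the vector of angle differences $\theta_{ij}=\theta_i-\theta_j$, $(i,j)\in\mathcal{E}$. $k\sim(i,j)$ means that $k\in\{1,\dots,|\mathcal{E}|\}$ is the index of edge $(i,j)$. $M=\mathrm{diag}(m_i)$, $D=\mathrm{diag}(d_i)$, $Y=\mathrm{diag}(y_{ij})_{(i,j)\in\mathcal{E}}$ have positive diagonal entries (inertias, dampings, line coefficients); $p\in\mathbb{R}^n$ is the vector of mechanical torques; $\sin,\cos$ of vectors act componentwise. $\theta^*$ satisfies $p=EY\sin(E^T\theta^* )$ and $\|E^T\theta^*\|_\infty<\pi/2$; $\theta^*_{ij}=\theta^*_i-\theta^*_j$. The state is $x=[(\theta-\theta^* )^T,\omega^T]^T\in\mathbb{R}^{2n}$, so the post-fault equilibrium is $x=0$. The dynamics $\dot\theta=\omega$, $M\dot\omega+D\omega=p-EY\sin(E^T\theta)$ are written in Lur'e form $\dot x=Ax-B\phi(z)$, $z=Cx$, with $$A=\begin{bmatrix}0&I\\ -M^{-1}EY\,\mathrm{diag}(\cos(E^T\theta^* ))E^T&-M^{-1}D\end{bmatrix},\quad B=\begin{bmatrix}0\\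 M^{-1}EY\end{bmatrix},\quad C=\begin{bmatrix}E^T&0\end{bmatrix},$$ and $\phi(z)=[\phi_1(z_1),\dots,\phi_{|\mathcal{E}|}(z_{|\mathcal{E}|})]^T$, where for $k\sim(i,j)$, $z_k=\theta_{ij}-\theta^*_{ij}$ and $\phi_k(z_k)=(\sin\theta_{ij}-\sin\theta^*_{ij})-\cos\theta^*_{ij}(\theta_{ij}-\theta^*_{ij})$. Operational constraints. $\mathcal{P}_1=\{x:\theta_{ij}\in[-\pi-\theta^*_{ij},\pi-\theta^*_{ij}]\ \forall(i,j)\in\mathcal{E}\}$, $\mathcal{P}_2=\{x:\theta_{ij},\theta_{ij}^*\in[-\pi/2,\pi/2]\ \forall(i,j)\in\mathcal{E}\}$. $\mathcal{P}=\{x:|\theta_{ij}|\le\overline{\theta}_{ij}\ \forall(i,j)\in\mathcal{E}\}$ with given bounds $\overline\theta_{ij}$ such that $\mathcal{P}_2\subseteq\mathcal{P}\subseteq\mathcal{P}_1$, and $\mathcal{S}=\{x:|\omega_i|\le\overline\omega_i\ \forall i\in\mathcal{N}\}$ with given $\overline\omega_i>0$. Sector bounds. For $k\sim(i,j)$, $\overline\delta_k=1-\cos\theta^*_{ij}$, and $\underline\delta_k$ is a fixed number such that $\phi_k(z_k)/z_k\in[\underline\delta_k,\overline\delta_k]$ for all $x\in\mathcal{P}$ with $z_k\neq0$; namely $\underline\delta_k=-\cos\theta_{ij}^*$ when $\mathcal{P}=\mathcal{P}_1$, $\underline\delta_k=\xi_k-\cos\theta^*_{ij}$ with $\xi_k=\frac{1-\sin|\theta^*_{ij}|}{\pi/2-|\theta^*_{ij}|}$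 when $\mathcal{P}=\mathcal{P}_2$, and for intermediate $\mathcal{P}$, $\underline\delta_k=\varphi_k-\cos\theta_{ij}^*$ with some $\varphi_k\in(0,\xi_k)$ for which the bound holds on $\mathcal{P}$. Lyapunov function and matrices. $$V(x)=x^TPx+2\sum_{k=1}^{|\mathcal{E}|}\lambda_k\int_0^{z_k(x)}(\overline\delta_k s-\phi_k(s))\,ds.$$ $\Lambda=\mathrm{diag}(\lambda_k)$, $\underline\Delta=\mathrm{diag}(\underline\delta_k)$, $\overline\Delta=\mathrm{diag}(\overline\delta_k)$, and $R=\begin{bmatrix}R_{11}&R_{12}\\R_{12}^T&R_{22}\end{bmatrix}$ with $R_{11}=A^T(P+C^T\Lambda\overline\Delta C)+(P+C^T\overline\Delta\Lambda C)A-2C^T\underline\Delta\Gamma\overline\Delta C$, $R_{12}=-PB-A^TC^T\Lambda+C^T(\underline\Delta+\overline\Delta)\Gamma$, $R_{22}=-2\Gamma$. The symbol $\preceq$ is the semidefinite order. Optimization problems. $\mathcal{P}_{ij}^{\pm}=\{x\in\mathcal{P}:\theta_{ij}=\pm\overline\theta_{ij}\}$ and $\mathcal{S}_i^{\pm}=\{x\in\mathcal{S}:\omega_i=\pm\overline\omega_i\}$. Then $V_{ij}^-=\min\{V(x):x\in\mathcal{P}_{ij}^-,\ \omega_i\le\omega_j\}$, $V_{ij}^+=\min\{V(x):x\in\mathcal{P}_{ij}^+,\ \omega_i\ge\omega_j\}$ for $(i,j)\in\mathcal{E}$, and $W_i^{\pm}=\min\{V(x):x\in\mathcal{S}_i^{\pm}\}$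 for $i\in\mathcal{N}$ (the minimum over an empty set is $+\infty$).
   Formalization: Convergence to x=0 is claimed except for trajectories starting at a nonzero equilibrium when 𝒫=𝒫₁; such equilibria can lie in 𝒳 (e.g. one machine with θ*=0 at θ=π, ω=0), and there the claim as stated is false. *)

(* Defs.v *)
From HB Require Import structures.
From mathcomp Require Import all_boot all_order all_algebra.
From mathcomp Require Import all_classical all_reals all_analysis.

Set Implicit Arguments.
Unset Strict Implicit.
Unset Printing Implicit Defensive.

Import Order.TTheory GRing.Theory Num.Theory.
Import numFieldNormedType.Exports.

Local Open Scope classical_set_scope.
Local Open Scope ring_scope.

(* Only symmetric matrices are compared, as usual for the semidefinite order. *)
Definition posdefmx (R : realType) (k : nat) (M : 'M[R]_k) : Prop :=
  M^T = M /\ forall v : 'cV[R]_k, v != 0 -> 0 < (v^T *m M *m v) 0 0.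

Definition possemidefmx (R : realType) (k : nat) (M : 'M[R]_k) : Prop :=
  M^T = M /\ forall v : 'cV[R]_k, 0 <= (v^T *m M *m v) 0 0.

Definition le_semidef (R : realType) (k : nat) (M N : 'M[R]_k) : Prop :=
  possemidefmx (N - M).

Definition diagf (R : realType) (k : nat) (d : 'I_k -> R) : 'M[R]_k :=
  diag_mx (\row_i d i).

(* Integral from [a] to [b], with the sign convention for [b < a]. *)
Definition oriented_integral (R : realType) (f : R -> R) (a b : R) : R :=
  if a <= b then (\int[lebesgue_measure]_(s in `[a, b]) f s)%R
  else - (\int[lebesgue_measure]_(s in `[b, a]) f s)%R.

(* A node is an [option 'I_n], [None] being the infinite bus; line [k] is
   oriented from [src k] to [dst k], i.e. k ~ (src k, dst k). *)
Record power_network (R : realType) (n m : nat) := PowerNetwork {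
  src : 'I_m -> option 'I_n;
  dst : 'I_m -> option 'I_n;
  inertia : 'I_n -> R;
  damping : 'I_n -> R;
  line_coef : 'I_m -> R;
  src_neq_dst : forall k, src k != dst k;
  (* the lines form a set: no two lines join the same unordered pair of nodes *)
  line_inj : injective (fun k => [set src k; dst k]%SET);
  network_connected : forall u v : option 'I_n,
    connect (fun a b => [exists k, ((src k == a) && (dst k == b))
                                || ((src k == b) && (dst k == a))]) u v;
  inertia_gt0 : forall i, 0 < inertia i;
  damping_gt0 : forall i, 0 < damping i;
  line_coef_gt0 : forall k, 0 < line_coef k
}.

Section PowerSystem.
Variables (R : realType) (n m : nat) (G : power_network R n m).

(* Extends a vector indexed by the generators to all nodes: the infinite bus
   has angle and frequency 0. *)
Definition nodal (v : 'cV[R]_n) (a : option 'I_n) : R :=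
  if a is Some i then v i 0 else 0.

Definition line_diff (v : 'cV[R]_n) (k : 'I_m) : R :=
  nodal v (src G k) - nodal v (dst G k).

Definition incidence : 'M[R]_(n, m) :=
  \matrix_(i, k) ((src G k == Some i)%:R - (dst G k == Some i)%:R).

Lemma incidence_trE (v : 'cV[R]_n) (k : 'I_m) :
  (incidence^T *m v) k 0 = line_diff v k.
Proof.
rewrite mxE /line_diff.
have nodalE a : \sum_i (a == Some i)%:R * v i 0 = nodal v a.
  case: a => [j|] /=; last by rewrite big1 // => i _; rewrite mul0r.
  rewrite (bigD1 j) //= eqxx mul1r big1 ?addr0 // => i ij.
  by rewrite (inj_eq Some_inj) eq_sym (negbTE ij) mul0r.
rewrite -!nodalE -sumrB; apply: eq_bigr => i _.
by rewrite !mxE mulrBl.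
Qed.

Definition inertia_mx : 'M[R]_n := diagf (inertia G).
Definition damping_mx : 'M[R]_n := diagf (damping G).
Definition line_mx : 'M[R]_m := diagf (line_coef G).

(* The vector E Y sin(E^T theta) of electrical torques. *)
Definition electrical_torque (theta : 'cV[R]_n) : 'cV[R]_n :=
  incidence *m line_mx *m map_mx sin (incidence^T *m theta).

Variable thetas : 'cV[R]_n.

Definition lure_A : 'M[R]_(n + n) :=
  block_mx
    0
    1%:M
    (- (invmx inertia_mx *m incidence *m line_mx
        *m diagf (fun k => cos (line_diff thetas k)) *m incidence^T))
    (- (invmx inertia_mx *m damping_mx)).

Definition lure_B : 'M[R]_(n + n, m) :=
  col_mx 0 (invmx inertia_mx *m incidence *m line_mx).

Definition lure_C : 'M[R]_(m, n + n) := row_mx incidence^T 0.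

Definition phi (k : 'I_m) (s : R) : R :=
  (sin (line_diff thetas k + s) - sin (line_diff thetas k))
  - cos (line_diff thetas k) * s.

Definition phi_vec (z : 'cV[R]_m) : 'cV[R]_m := \col_k phi k (z k 0).

Definition lure_field (x : 'cV[R]_(n + n)) : 'cV[R]_(n + n) :=
  lure_A *m x - lure_B *m phi_vec (lure_C *m x).

Definition state (theta omega : 'cV[R]_n) : 'cV[R]_(n + n) :=
  col_mx (theta - thetas) omega.

(* theta and omega recovered from x = [theta - theta^*; omega]. *)
Definition angle_of (x : 'cV[R]_(n + n)) : 'cV[R]_n := usubmx x + thetas.
Definition freq_of (x : 'cV[R]_(n + n)) : 'cV[R]_n := dsubmx x.

(* Solutions on [0, +oo[: continuous there, differentiable for t > 0 (the
   one-sided derivative at 0 then follows from the equation). *)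
Definition lure_trajectory (x : R -> 'cV[R]_(n + n)) : Prop :=
  (forall i, {within `[0, +oo[, continuous (fun t => x t i 0)}) /\
  (forall (t : R) i, 0 < t ->
     is_derive t 1 (fun s => x s i 0) (lure_field (x t) i 0)).

Definition swing_trajectory (p : 'cV[R]_n) (theta omega : R -> 'cV[R]_n) : Prop :=
  [/\ forall i, {within `[0, +oo[, continuous (fun t => theta t i 0)},
      forall i, {within `[0, +oo[, continuous (fun t => omega t i 0)},
      forall (t : R) i, 0 < t -> is_derive t 1 (fun s => theta s i 0) (omega t i 0) &
      forall t : R, 0 < t ->
        (forall i, derivable (fun s => omega s i 0) t 1) /\
        inertia_mx *m (\col_i derive1 (fun s => omega s i 0) t)
          + damping_mx *m omega t = p - electrical_torque (theta t)].

Definition constraint_P1 : set 'cV[R]_(n + n) :=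
  [set x | forall k, - pi - line_diff thetas k <= line_diff (angle_of x) k
                     <= pi - line_diff thetas k].

Definition constraint_P2 : set 'cV[R]_(n + n) :=
  [set x | forall k, - (pi / 2) <= line_diff (angle_of x) k <= pi / 2
                  /\ - (pi / 2) <= line_diff thetas k <= pi / 2].

Definition constraint_P (theta_bar : 'I_m -> R) : set 'cV[R]_(n + n) :=
  [set x | forall k, `|line_diff (angle_of x) k| <= theta_bar k].

Definition constraint_S (omega_bar : 'I_n -> R) : set 'cV[R]_(n + n) :=
  [set x | forall i, `|freq_of x i 0| <= omega_bar i].

Definition sector_up (k : 'I_m) : R := 1 - cos (line_diff thetas k).

Definition xi (k : 'I_m) : R :=
  (1 - sin `|line_diff thetas k|) / (pi / 2 - `|line_diff thetas k|).

Definition sector_bounds (theta_bar delta_low : 'I_m -> R) : Prop :=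
  let Pc := constraint_P theta_bar in
  [/\ forall k x, Pc x -> let z := (lure_C *m x) k 0 in
        z != 0 -> delta_low k <= phi k z / z <= sector_up k,
      Pc = constraint_P1 ->
        forall k, delta_low k = - cos (line_diff thetas k),
      Pc = constraint_P2 ->
        forall k, delta_low k = xi k - cos (line_diff thetas k) &
      Pc <> constraint_P1 -> Pc <> constraint_P2 ->
        forall k, exists2 vphi, 0 < vphi < xi k &
          delta_low k = vphi - cos (line_diff thetas k)].

Definition lyapunov (P : 'M[R]_(n + n)) (lambda : 'I_m -> R)
    (x : 'cV[R]_(n + n)) : R :=
  (x^T *m P *m x) 0 0
  + 2 * \sum_k lambda k *
      oriented_integral (fun s => sector_up k * s - phi k s)
                        0 ((lure_C *m x) k 0).

Definition lmi_R (delta_low : 'I_m -> R) (P : 'M[R]_(n + n))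
    (lambda : 'I_m -> R) (Gamma : 'M[R]_m) : 'M[R]_(n + n + m) :=
  let A := lure_A in let B := lure_B in let C := lure_C in
  let L := diagf lambda in
  let Dlow := diagf delta_low in let Dup := diagf sector_up in
  let R11 := A^T *m (P + C^T *m L *m Dup *m C)
             + (P + C^T *m Dup *m L *m C) *m A
             - 2 *: (C^T *m Dlow *m Gamma *m Dup *m C) in
  let R12 := - (P *m B) - A^T *m C^T *m L + C^T *m (Dlow + Dup) *m Gamma in
  let R22 := - (2 *: Gamma) in
  block_mx R11 R12 R12^T R22.

(* The minimum of V over a set, +oo if the set is empty.  The sets below are
   closed and V is continuous and coercive, so the infimum is attained whenever
   the set is nonempty. *)
Definition emin (V : 'cV[R]_(n + n) -> R) (A : set 'cV[R]_(n + n)) : \bar R :=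
  ereal_inf [set (V x)%:E | x in A].

Definition Vminus (V : 'cV[R]_(n + n) -> R) (theta_bar : 'I_m -> R)
    (k : 'I_m) : \bar R :=
  emin V [set x | [/\ constraint_P theta_bar x,
                      line_diff (angle_of x) k = - theta_bar k &
                      nodal (freq_of x) (src G k) <= nodal (freq_of x) (dst G k)]].

Definition Vplus (V : 'cV[R]_(n + n) -> R) (theta_bar : 'I_m -> R)
    (k : 'I_m) : \bar R :=
  emin V [set x | [/\ constraint_P theta_bar x,
                      line_diff (angle_of x) k = theta_bar k &
                      nodal (freq_of x) (src G k) >= nodal (freq_of x) (dst G k)]].

Definition Wminus (V : 'cV[R]_(n + n) -> R) (omega_bar : 'I_n -> R)
    (i : 'I_n) : \bar R :=
  emin V [set x | constraint_S omega_bar x /\ freq_of x i 0 = - omega_bar i].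

Definition Wplus (V : 'cV[R]_(n + n) -> R) (omega_bar : 'I_n -> R)
    (i : 'I_n) : \bar R :=
  emin V [set x | constraint_S omega_bar x /\ freq_of x i 0 = omega_bar i].

Definition Vmax (V : 'cV[R]_(n + n) -> R) (theta_bar : 'I_m -> R)
    (omega_bar : 'I_n -> R) : \bar R :=
  Order.min
    (\big[Order.min/+oo%E]_(k < m)
        Order.min (Vminus V theta_bar k) (Vplus V theta_bar k))
    (\big[Order.min/+oo%E]_(i < n)
        Order.min (Wminus V omega_bar i) (Wplus V omega_bar i)).

Definition roa_estimate (V : 'cV[R]_(n + n) -> R) (theta_bar : 'I_m -> R)
    (omega_bar : 'I_n -> R) : set 'cV[R]_(n + n) :=
  [set x | ((V x)%:E <= Vmax V theta_bar omega_bar)%E]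
    `&` constraint_P theta_bar.

Definition invariant_set (X : set 'cV[R]_(n + n)) : Prop :=
  forall x : R -> 'cV[R]_(n + n), lure_trajectory x -> X (x 0) ->
    forall t, 0 <= t -> X (x t).

(* When P = P_1, an equilibrium other than 0 can belong to the estimated region
   of attraction (e.g. the upright position theta = pi, omega = 0 of a single
   machine with theta^* = 0); the trajectory starting there is constant. *)
Definition boundary_rest_point (theta_bar : 'I_m -> R) (x0 : 'cV[R]_(n + n)) : Prop :=
  [/\ constraint_P theta_bar = constraint_P1, lure_field x0 = 0 & x0 != 0].

End PowerSystem.

(* Main.v *)
(* V is a positive definite function whose derivative along a trajectory is, on the
   constraint set, at most minus a weighted sum of the sector defects
   (phi_k - delta_low_k z_k) (sector_up_k z_k - phi_k), each of them nonnegative.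

   Invariance.  A trajectory x in X could leave the constraint set right after some time
   T only where V (x T) = Vmax, so the minimality of Vmax alone does not exclude it.
   Instead one follows s x(t) for s < 1 close to 1: it starts strictly inside, since
   V (s x) <= V x - (1 - s) x^T P x, and V increases along it by at most O(1 - s) per
   unit of time, the field being homogeneous up to O(1 - s).  If x exits soon after T,
   then s x also exits, through a barrier point with outward velocity where V < Vmax,
   which is impossible.

   Convergence.  V (x t) is nonincreasing and bounded below, and the line deviations z_k
   are Lipschitz; hence z_k eventually avoids each value at which its sector defect is
   nonzero.  Such values are dense, so z_k converges.  The graph being connected to the
   infinite bus, the angles converge; by Barbalat's lemma the frequencies tend to 0, and
   the limit y is a rest point.  If y <> 0, then P = P_1 and y lies on the boundary of
   the constraint set, so that V y >= Vmax; then V is constant along the trajectory,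
   which is therefore constant and equal to y. *)

Require Import Defs.
From HB Require Import structures.
From mathcomp Require Import all_boot all_order all_algebra.
From mathcomp Require Import all_classical all_reals all_analysis.
From mathcomp Require Import ring lra.

Set Implicit Arguments.
Unset Strict Implicit.
Unset Printing Implicit Defensive.

Import Order.TTheory GRing.Theory Num.Theory.
Import numFieldNormedType.Exports.

Local Open Scope classical_set_scope.
Local Open Scope ring_scope.

(** * Scalar analysis *)

Section ScalarAnalysis.
Variable R : realType.
Implicit Types (f df g dg u h Q : R -> R) (a b c s t L B l k : R).

(** The hypotheses fit a trajectory frozen at its initial state for negative times: continuous on
    the whole line, differentiable only at positive times. Intervals starting at 0 are thus
    allowed. *)
Lemma MVT_pos f df a b : continuous f ->
  (forall t, 0 < t -> is_derive t 1 f (df t)) -> 0 <= a -> a < b ->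
  exists2 c, a < c < b & f b - f a = df c * (b - a).
Proof.
move=> cf fd a0 ab.
have fd' t : t \in `]a, b[ -> is_derive t 1 f (df t).
  by rewrite in_itv/= => /andP[at_ _]; apply: fd; exact: le_lt_trans at_.
have [c] := MVT ab fd' (continuous_subspaceT cf).
by rewrite in_itv /= => cab e; exists c.
Qed.

Lemma derive_le0_nincr f df a b : continuous f ->
  (forall t, 0 < t -> is_derive t 1 f (df t)) -> 0 <= a -> a <= b ->
  (forall t, a < t < b -> df t <= 0) -> f b <= f a.
Proof.
move=> cf fd a0; rewrite le_eqVlt => /predU1P[->//|ab] neg.
have [c cab e] := MVT_pos cf fd a0 ab.
by rewrite -subr_le0 e mulr_le0_ge0 ?neg// subr_ge0 ltW.
Qed.

Lemma derive_bounded_lipschitz f df L : continuous f ->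
  (forall t, 0 < t -> is_derive t 1 f (df t)) ->
  (forall t, 0 < t -> `|df t| <= L) ->
  forall s t, 0 <= s -> s <= t -> `|f t - f s| <= L * (t - s).
Proof.
move=> cf fd bd s t s0; rewrite le_eqVlt => /predU1P[->|st].
  by rewrite !subrr normr0 mulr0.
have [c /andP[sc _] ->] := MVT_pos cf fd s0 st.
rewrite normrM (gtr0_norm (x := t - s)) ?subr_gt0//.
by rewrite ler_wpM2r ?bd ?subr_ge0 ?(ltW st)//; exact: le_lt_trans sc.
Qed.

Lemma near_ball_lt (P : R -> Prop) c : (\forall s \near c, P s) ->
  exists2 e, 0 < e & forall s, `|s - c| < e -> P s.
Proof.
move=> /nbhs_ballP[e /= e0 sub]; exists e => // s sc.
by apply: sub; rewrite /ball/= distrC.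
Qed.

(** The time is the infimum of those at which some [h i] is nonnegative. As [I] is finite, strict
    signs at that time persist on a common neighbourhood. *)
Lemma first_crossing (I : finType) (h : I -> R -> R) a b : a <= b ->
  (forall i, continuous (h i)) -> (forall i, h i a < 0) ->
  (exists i, 0 <= h i b) ->
  exists t i, [/\ a < t <= b, h i t = 0 &
    forall j s, a <= s <= t -> h j s <= 0].
Proof.
move=> ab hc ha hb.
pose S := [set t : R | a <= t <= b /\ exists i, 0 <= h i t].
have Sb : S b by split => //; rewrite ab lexx.
have Slb : lbound S a by move=> t [/andP[]].
have Si : has_inf S by split; [exists b|exists a].
pose c := inf S.
have ac : a <= c by apply: lb_le_inf; [exists b|].
have cb : c <= b by apply: ge_inf => //; exists a.
(* If every [h i] were negative at [c], all would stay negative slightly beyond [c], which would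
   then not be the infimum. *)
have [i hi] : exists i, 0 <= h i c.
  apply: contrapT => nex.
  have neg i : h i c < 0 by rewrite ltNge; apply/negP => ?; apply: nex; exists i.
  have [e e0 He] : exists2 e, 0 < e & forall s, `|s - c| < e -> forall i, h i s < 0.
    suff : \forall s \near c, forall i, h i s < 0 by exact: near_ball_lt.
    apply: (@filter_forall _ _ (fun i s => h i s < 0) (nbhs c) _) => i.
    by apply: (cvgr_lt (h i c)) => //; exact: hc.
  have [s Ss sc] := inf_adherent e0 Si.
  case: (Ss) => _ [i]; apply/negP; rewrite -ltNge; apply: He.
  have cs : c <= s by apply: ge_inf => //; exists a.
  rewrite ger0_norm ?subr_ge0//; have : s < c + e := sc; lra.
have ac' : a < c.
  rewrite lt_neqAle ac andbT; apply/negP => /eqP ac'.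
  by move: hi; rewrite -ac' leNgt ha.
have below j s : a <= s < c -> h j s < 0.
  move=> /andP[as_ sc]; rewrite ltNge; apply/negP => hj.
  have : c <= s.
    apply: ge_inf; first by exists a.
    by split; [rewrite as_ (le_trans (ltW sc))|exists j].
  by rewrite leNgt sc.
have atc j : h j c <= 0.
  rewrite leNgt; apply/negP => hj.
  have [e e0 He] : exists2 e, 0 < e & forall s, `|s - c| < e -> 0 < h j s.
    suff : \forall s \near c, 0 < h j s by exact: near_ball_lt.
    exact: (cvgr_gt (h j c) (hc j c) _ hj).
  pose s := Num.max a (c - e / 2).
  have sc : s < c by rewrite gt_max ac'/=; lra.
  have as_ : a <= s by rewrite le_max lexx.
  have /He : `|s - c| < e.
    rewrite ltr0_norm ?subr_lt0//.
    have : c - e / 2 <= s by rewrite le_max lexx orbT.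
    lra.
  by apply/negP; rewrite -leNgt ltW// below// as_.
exists c, i; split => //.
- by rewrite ac'.
- by apply/eqP; rewrite eq_le atc.
- move=> j s /andP[as_]; rewrite le_eqVlt => /predU1P[->//|sc].
  by rewrite ltW// below// as_.
Qed.

(** After a visit to [c], the Lipschitz bound keeps [u] near [c], where [Q] exceeds [Q c / 2], for a
    fixed time [tau]; this costs [g] at least [Q c / 2 * tau]. Once [g] is within that amount of its
    infimum, no further visit can occur. If [Q c < 0], no visit at a positive time is possible at
    all. *)
Lemma eventually_avoids g dg u Q L b c : continuous g ->
  (forall t, 0 < t -> is_derive t 1 g (dg t)) ->
  (forall t, 0 < t -> dg t <= - Q (u t)) ->
  (forall t, 0 < t -> 0 <= Q (u t)) ->
  (forall t, 0 <= t -> b <= g t) ->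
  (forall s t, 0 <= s -> s <= t -> `|u t - u s| <= L * (t - s)) ->
  Q @ c --> Q c -> Q c != 0 ->
  exists2 T, 0 < T & forall t, T <= t -> u t != c.
Proof.
move=> cg gd dgQ Q0 gb uL cQ; rewrite neq_lt => /orP[Qc|Qc].
  exists 1 => // t t1; apply/negP => /eqP utc.
  have := Q0 t (lt_le_trans ltr01 t1).
  by rewrite utc leNgt Qc.
have [r r0 Hr] : exists2 r, 0 < r & forall s, `|s - c| < r -> Q c / 2 < Q s.
  suff : \forall s \near c, Q c / 2 < Q s by exact: near_ball_lt.
  by apply: (cvgr_gt (Q c) cQ); lra.
(* In time [tau] the function [u] moves by less than [r]; the [+ 1] keeps the denominator positive
   when [L = 0]. *)
pose tau := r / (2 * (`|L| + 1)).
have L1 : 0 < `|L| + 1 by rewrite ltr_pwDr.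
have tau0 : 0 < tau by rewrite divr_gt0// mulr_gt0.
have Ltau : (`|L| + 1) * tau = r / 2 by rewrite /tau; field; rewrite gt_eqF.
pose S := [set g t | t in [set t | 0 <= t]].
have Slb : has_lbound S by exists b => _ [t t0 <-]; exact: gb.
have Si : has_inf S by split => //; exists (g 0), 0 => /=.
have et0 : 0 < Q c / 2 * tau by rewrite mulr_gt0// divr_gt0.
have [_ [T /= T0 <-] gT] := inf_adherent et0 Si.
have ninc s t : 0 <= s -> s <= t -> g t <= g s.
  move=> s0 st; apply: (derive_le0_nincr cg gd) => // v /andP[sv _].
  have v0 : 0 < v by exact: le_lt_trans sv.
  by apply: le_trans (dgQ _ v0) _; rewrite oppr_le0 Q0.
exists (T + 1); first by rewrite ltr_wpDl.
move=> t Tt; apply/negP => /eqP utc.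
have t0 : 0 < t by lra.
have tt' : t < t + tau by rewrite ltrDl.
have [v /andP[tv vt] e] := MVT_pos cg gd (ltW t0) tt'.
have v0 : 0 < v by exact: lt_trans tv.
have : Q c / 2 < Q (u v).
  apply: Hr; rewrite -utc; apply: le_lt_trans (uL _ _ (ltW t0) (ltW tv)) _.
  have : L * (v - t) <= `|L| * tau.
    apply: le_trans (_ : `|L| * (v - t) <= _).
      by rewrite ler_wpM2r ?ler_norm// subr_ge0 ltW.
    by rewrite ler_wpM2l//; lra.
  have := Ltau; rewrite mulrDl mul1r; lra.
have := dgQ _ v0; move=> h1 h2.
have : g (t + tau) < inf S.
  have := ninc T t T0; have -> : T <= t by lra.
  move=> /(_ isT) h3.
  have : dg v * tau <= - (Q c / 2) * tau by rewrite ler_wpM2r ?(ltW tau0)//; lra.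
  by move: e gT; rewrite (_ : t + tau - t = tau); [lra|ring].
apply/negP; rewrite -leNgt; apply: ge_inf => //.
by exists (t + tau) => //=; lra.
Qed.

Lemma cvg_pinfty_dist u l : u t @[t --> +oo] --> l <->
  forall e, 0 < e -> exists2 T, 0 < T & forall t, T <= t -> `|u t - l| < e.
Proof.
rewrite (@cvgrPdist_lt R R); split => ucvg e e0.
  have [M [_ HM]] := ucvg e e0.
  exists (Num.max 0 M + 1) => [|t Mt]; first by rewrite ltr_wpDl// le_max lexx.
  rewrite distrC; apply: HM; apply: lt_le_trans Mt.
  by rewrite ltr_pwDr// le_max lexx orbT.
have [T _ HT] := ucvg e e0.
by exists T; split; [exact: num_real|move=> t Tt; rewrite distrC HT// ltW].
Qed.

Lemma ivt_avoids u T c : continuous u -> (forall t, T <= t -> u t != c) ->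
  (forall t, T <= t -> u t < c) \/ (forall t, T <= t -> c < u t).
Proof.
move=> cu uc.
have aux s t : T <= s -> T <= t -> u s < c -> c < u t -> False.
  move=> Ts Tt us ut.
  have [st|ts] := leP s t.
    have [|v] := @IVT R u s t c st (continuous_subspaceT cu).
      by rewrite ge_min le_max (ltW us) (ltW ut) orbT.
    by rewrite in_itv/= => /andP[sv _]; apply/eqP/uc; exact: le_trans sv.
  have [|v] := @IVT R u t s c (ltW ts) (continuous_subspaceT cu).
    by rewrite ge_min le_max (ltW us) (ltW ut) orbT.
  by rewrite in_itv/= => /andP[sv _]; apply/eqP/uc; exact: le_trans sv.
have := uc T (lexx T); rewrite neq_lt => /orP[uT|uT]; [left|right] => t Tt;
  have := uc t Tt; rewrite neq_lt => /orP[ut|ut] //; exfalso.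
- exact: aux (lexx T) Tt uT ut.
- exact: aux Tt (lexx T) ut uT.
Qed.

(** Two distinct values at positive times would enclose an avoided level, against the intermediate
    value theorem; continuity then reaches time 0. *)
Lemma avoids_cst u : continuous u ->
  (forall a b, a < b -> exists2 c, a < c < b & forall t, 0 < t -> u t != c) ->
  forall t, 0 <= t -> u t = u 0.
Proof.
move=> cu av.
have pos s t : 0 < s -> s <= t -> u s = u t.
  move=> s0 st; apply/eqP; apply/negP => /negP.
  have ucs c : (forall v, 0 < v -> u v != c) -> forall v, s <= v -> u v != c.
    by move=> H v sv; apply: H; exact: lt_le_trans sv.
  rewrite neq_lt => /orP[] /av[c /andP[h1 h2] /ucs/(ivt_avoids cu)[] H].
  - by have := H _ st; rewrite ltNge ltW.
  - by have := H _ (lexx s); rewrite ltNge ltW.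
  - by have := H _ (lexx s); rewrite ltNge ltW.
  - by have := H _ st; rewrite ltNge ltW.
move=> t; rewrite le_eqVlt => /predU1P[<-//|t0].
apply/eqP; rewrite -subr_eq0 -normr_le0; apply/ler_addgt0Pl => e e0; rewrite addr0.
have : \forall s \near 0, `|u 0 - u s| < e.
  exact: ((@cvgrPdist_lt R R _ _ _ u (u 0)).1 (cu 0) e e0).
move=> /near_ball_lt[d d0 Hd].
pose s := Num.min t (d / 2).
have s0 : 0 < s by rewrite lt_min t0/= divr_gt0.
rewrite -(@pos s t)// ?ge_min ?lexx// distrC ltW// Hd// subr0 gtr0_norm//.
have : s <= d / 2 by rewrite ge_min lexx orbT.
lra.
Qed.

(** The limit is the supremum of the levels above which [u] eventually stays. An avoided level just
    above this supremum must eventually lie above [u]. *)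
Lemma avoids_cvg u B : continuous u -> (forall t, 0 <= t -> `|u t| <= B) ->
  (forall a b, a < b -> exists2 c, a < c < b &
     exists2 T, 0 < T & forall t, T <= t -> u t != c) ->
  exists l : R, u t @[t --> +oo] --> l.
Proof.
move=> cu uB av.
have uBe t : 0 <= t -> - B <= u t <= B by move=> /uB; rewrite ler_norml.
pose S := [set c | exists2 T, 0 < T & forall t, T <= t -> c < u t].
have SN : has_sup S.
  split; last first.
    exists B => c [T T0 /(_ _ (lexx T)) cT].
    by have /andP[_] := uBe T (ltW T0); apply: le_trans; exact: ltW.
  exists (- B - 1), 1 => // t t1.
  have /andP[] := uBe t (le_trans ler01 t1); lra.
exists (sup S); apply/cvg_pinfty_dist => e e0.
have [c [T1 T10 HT1] cS] := sup_adherent e0 SN.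
have [c' /andP[h1 h2] [T2 T20 HT2]] := av (sup S) (sup S + e) ltac:(lra).
have [H|H] := ivt_avoids cu HT2; last first.
  have : c' <= sup S by apply: sup_ubound; [case: SN|exists T2].
  by rewrite leNgt h1.
exists (Num.max T1 T2); first by rewrite lt_max T10.
move=> t; rewrite ge_max => /andP[/HT1 a1 /H a2].
rewrite ltr_norml; apply/andP; split; lra.
Qed.

(** Late in time [f] hardly moves over a window of length [tau], so [df] is below [e / 2] in size
    somewhere in it; the Lipschitz bound carries this back to the left end at the cost of another
    [e / 2]. *)
Lemma barbalat f df L l : continuous f -> f t @[t --> +oo] --> l ->
  (forall t, 0 < t -> is_derive t 1 f (df t)) ->
  (forall s t, 0 <= s -> s <= t -> `|df t - df s| <= L * (t - s)) ->
  df t @[t --> +oo] --> 0.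
Proof.
move=> cf fl fd dfL; apply/cvg_pinfty_dist => e e0.
have L1 : 0 < `|L| + 1 by rewrite ltr_pwDr.
pose tau := e / (2 * (`|L| + 1)).
have tau0 : 0 < tau by rewrite divr_gt0// mulr_gt0.
have Ltau : (`|L| + 1) * tau = e / 2 by rewrite /tau; field; rewrite gt_eqF.
have et0 : 0 < e * tau / 4 by rewrite divr_gt0// mulr_gt0.
have [T T0 HT] := (cvg_pinfty_dist f l).1 fl _ et0.
exists T => // t Tt; rewrite subr0.
have t0 : 0 < t by exact: lt_le_trans Tt.
have tt' : t < t + tau by rewrite ltrDl.
have [v /andP[tv vt] ev] := MVT_pos cf fd (ltW t0) tt'.
have /andP[a1 a2] : - (e / 2) < df v < e / 2.
  rewrite -ltr_norml -(ltr_pM2r tau0) -{1}(gtr0_norm tau0) -normrM.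
  have -> : df v * tau = f (t + tau) - f t by rewrite ev; ring.
  have := HT t Tt; have := HT (t + tau) (le_trans Tt (ltW tt')).
  by rewrite !ltr_norml => /andP[? ?] /andP[? ?]; apply/andP; split; lra.
have := dfL t v (ltW t0) (ltW tv).
have : L * (v - t) <= `|L| * tau.
  apply: le_trans (_ : `|L| * (v - t) <= _).
    by rewrite ler_wpM2r ?ler_norm// subr_ge0 ltW.
  by rewrite ler_wpM2l//; lra.
move=> b1 b2; have := le_trans b2 b1; rewrite ler_norml => /andP[b3 b4].
have : `|L| * tau < e / 2 by rewrite -Ltau mulrDl mul1r ltrDl.
by move=> b5; rewrite ltr_norml; apply/andP; split; lra.
Qed.

(** The increments of [f] over unit intervals tend to 0, and each is a value of [df]. *)
Lemma cvg_derive_eq0 f df l k : continuous f -> f t @[t --> +oo] --> l ->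
  (forall t, 0 < t -> is_derive t 1 f (df t)) ->
  df t @[t --> +oo] --> k -> k = 0.
Proof.
move=> cf fl fd dfk.
apply/eqP; rewrite -normr_le0; apply/ler_addgt0Pl => e e0; rewrite addr0.
have e4 : 0 < e / 4 by rewrite divr_gt0.
have [T T0 HT] := (cvg_pinfty_dist f l).1 fl _ e4.
have [T' T0' HT'] := (cvg_pinfty_dist df k).1 dfk _ e4.
pose t := Num.max T T'.
have Tt : T <= t by rewrite le_max lexx.
have Tt' : T' <= t by rewrite le_max lexx orbT.
have t0 : 0 < t by exact: lt_le_trans Tt.
have tt' : t < t + 1 by rewrite ltrDl.
have [v /andP[tv vt] ev] := MVT_pos cf fd (ltW t0) tt'.
have := HT' v (le_trans Tt' (ltW tv)).
have := HT t Tt; have := HT (t + 1) (le_trans Tt (ltW tt')).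
move: ev; rewrite (_ : t + 1 - t = 1) ?mulr1; last by ring.
rewrite !ltr_norml ler_norml => ev /andP[? ?] /andP[? ?] /andP[? ?].
by apply/andP; split; lra.
Qed.

End ScalarAnalysis.

(** * The sector nonlinearity *)

Section PointwiseDerivative.
Variable R : realType.
Implicit Types (f g : R -> R) (t df dg a : R).

(** From here to [is_derive_pt_comp], the differentiation rules are put in pointwise form, which
    fits functions of time. *)
Lemma is_derive_pt_cst a t : is_derive t 1 (fun _ : R => a) 0.
Proof. exact: is_derive_cst. Qed.

Lemma is_derive_pt_id t : is_derive t 1 (fun s : R => s) 1.
Proof. exact: is_derive_id. Qed.

Lemma is_derive_ptD f g t df dg : is_derive t 1 f df -> is_derive t 1 g dg ->
  is_derive t 1 (fun s => f s + g s) (df + dg).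
Proof. exact: is_deriveD. Qed.

Lemma is_derive_ptM f g t df dg : is_derive t 1 f df -> is_derive t 1 g dg ->
  is_derive t 1 (fun s => f s * g s) (df * g t + f t * dg).
Proof.
move=> hf hg; apply: (@is_derive_eq _ _ _ (f * g)).
by rewrite addrC mulrC.
Qed.

Lemma is_derive_ptZ f t df a : is_derive t 1 f df ->
  is_derive t 1 (fun s => a * f s) (a * df).
Proof. exact: is_deriveZ. Qed.

Lemma is_derive_pt_sum (N : nat) (h : 'I_N -> R -> R) (dh : 'I_N -> R) t :
  (forall i, is_derive t 1 (h i) (dh i)) ->
  is_derive t 1 (fun s => \sum_i h i s) (\sum_i dh i).
Proof.
by move=> hd; rewrite -fct_sumE; exact: is_derive_sum.
Qed.

Lemma is_derive_pt_comp f g t df dg : is_derive (g t) 1 f df -> is_derive t 1 g dg ->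
  is_derive t 1 (fun s => f (g s)) (df * dg).
Proof. exact: is_derive1_comp. Qed.

Lemma is_derive_pt_cont f t df : is_derive t 1 f df -> f @ t --> f t.
Proof.
by case=> fd _; apply: differentiable_continuous; apply/derivable1_diffP.
Qed.

Lemma norm_sinB (a b : R) : `|sin a - sin b| <= `|a - b|.
Proof.
wlog ab : a b / b <= a => [H|].
  by have [/H//|/ltW/H] := leP b a; rewrite distrC [leRHS]distrC.
have [c _ ->] := MVT_segment ab (fun x _ => is_derive_sin x)
  (continuous_subspaceT (@continuous_sin R)).
by rewrite normrM ler_piMl// ler_norml cos_geN1 cos_le1.
Qed.

Lemma norm_sin_le (y : R) : `|sin y| <= `|y|.
Proof. by have := norm_sinB y 0; rewrite sin0 !subr0. Qed.

(** With [x = y / 2], the double angle formula gives [|sin y| <= |y| |cos x|]. If [y] were nonzero,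
    then [|cos x| = 1], so [sin x = 0], [sin y = 0] and [y = 0]. *)
Lemma norm_sin_eq (y : R) : `|y| <= `|sin y| -> y = 0.
Proof.
move=> yy; apply/eqP/negP => /negP y0.
pose x := y / 2; have yE : y = x *+ 2 by rewrite /x mulr2n; lra.
have ny0 : 0 < `|y| by rewrite normr_gt0.
have sx := norm_sin_le x.
have yx : `|y| = `|x| *+ 2 by rewrite yE normrMn.
have c1 : 1 <= `|cos x|.
  rewrite -(ler_pM2r ny0) mul1r; apply: le_trans yy _.
  by rewrite yx yE sin_mulr2n normrMn normrM -mulrnAr ler_wpM2l// lerMn2r sx orbT.
have : sin x ^+ 2 <= 0.
  by rewrite sin2cos2 subr_le0 -real_normK ?num_real// expr_ge1.
rewrite exprn_even_le0//= => /eqP sx0.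
by move: yy; rewrite yE sin_mulr2n sx0 mulr0 mul0rn normr0 -yE leNgt ny0.
Qed.

(** The sine increment is [2 cos (a + x) sin x] with [x = z / 2], so the hypothesis forces
    [|x| <= |sin x|]. This shows that the upper factor of a sector defect vanishes only at 0. *)
Lemma sinDB_eq_id (a z : R) : sin (a + z) - sin a = z -> z = 0.
Proof.
move=> e; pose x := z / 2; have zE : z = x *+ 2 by rewrite /x mulr2n; lra.
suff : x = 0 by rewrite zE => ->; rewrite mul0rn.
apply: norm_sin_eq.
have : z = (cos (a + x) * sin x) *+ 2.
  rewrite -[LHS]e (_ : a + z = (a + x) + x); last by rewrite zE; ring.
  by rewrite -{2}[a](addrK x) sinB sinD; ring.
move=> /(congr1 (fun v => `|v|)); rewrite {1}zE !normrMn normrM.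
move=> /eqP; rewrite eqrMn2r//= => /eqP ->.
by rewrite normrM ler_piMl// ler_norml cos_geN1 cos_le1.
Qed.

End PointwiseDerivative.

Section SectorNonlinearity.
Variables (R : realType) (n m : nat) (G : power_network R n m).
Variable thetas : 'cV[R]_n.
Local Notation ts := (line_diff G thetas).
Implicit Types (k : 'I_m) (s z a b d : R).

(** The primitive, zero at 0, of [s - (sin (ts k + s) - sin (ts k))], to which the integrand in
    [lyapunov] simplifies. *)
Definition lure_potential k z : R :=
  z ^+ 2 / 2 + cos (ts k + z) - cos (ts k) + sin (ts k) * z.

Lemma is_derive_lure_potential k z :
  is_derive z 1 (lure_potential k) (sector_up G thetas k * z - phi G thetas k z).
Proof.
have hid := is_derive_pt_id z; have hcst a := is_derive_pt_cst a z.
have h1 := is_derive_pt_comp (is_derive_cos (ts k + z)) (is_derive_ptD (hcst (ts k)) hid).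
have h2 := is_derive_ptZ 2^-1 (is_derive_ptM hid hid).
have := is_derive_ptD (is_derive_ptD (is_derive_ptD h2 h1) (hcst (- cos (ts k))))
          (is_derive_ptZ (sin (ts k)) hid).
rewrite (_ : (fun s => _) = lure_potential k).
  by move=> /is_derive_eq; apply; rewrite /sector_up /phi; field.
by apply/funext => s; rewrite /lure_potential; field.
Qed.

Lemma continuous_phi k : continuous (phi G thetas k).
Proof.
move=> z; rewrite /phi; apply: cvgB; last by apply: cvgM; [exact: cvg_cst|exact: cvg_id].
apply: cvgB; last exact: cvg_cst.
apply: continuous_comp; last exact: continuous_sin.
by apply: cvgD; [exact: cvg_cst|exact: cvg_id].
Qed.

Lemma lure_potentialE k z :
  oriented_integral (fun s => sector_up G thetas k * s - phi G thetas k s) 0 z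
  = lure_potential k z.
Proof.
pose f s := sector_up G thetas k * s - phi G thetas k s.
have cf : continuous f.
  move=> s; apply: cvgB; last exact: continuous_phi.
  by apply: cvgM; [exact: cvg_cst|exact: cvg_id].
have F0 : lure_potential k 0 = 0.
  by rewrite /lure_potential addr0 expr0n/= !mul0r mulr0 add0r subrr addr0.
have dF s : is_derive s 1 (lure_potential k) (f s) by exact: is_derive_lure_potential.
have cF s : {for s, continuous (lure_potential k)}.
  exact: is_derive_pt_cont (dF s).
have ftc a b : a < b ->
    \int[lebesgue_measure]_(s in `[a, b]) f s = lure_potential k b - lure_potential k a.
  move=> ab; rewrite /Rintegral.
  rewrite (continuous_FTC2 (F := lure_potential k) ab (continuous_subspaceT cf))//.
    split => [s _||].
    - by case: (dF s).
    - exact: cvg_at_right_filter (cF a).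
    - exact: cvg_at_left_filter (cF b).
  by move=> s _; rewrite derive1E derive_val.
rewrite /oriented_integral -/f; case: ifPn => [|/negP/negP].
  rewrite le_eqVlt => /predU1P[<-|z0]; last by rewrite ftc// F0 subr0.
  by rewrite set_itv1 /Rintegral integral_set1.
by rewrite -ltNge => z0; rewrite ftc// F0 sub0r opprK.
Qed.

Lemma norm_phi_le k z : `|phi G thetas k z| <= 2 * `|z|.
Proof.
rewrite /phi; apply: le_trans (ler_normB _ _) _.
have h1 := norm_sinB (ts k + z) (ts k).
have h2 : `|cos (ts k) * z| <= `|z|.
  by rewrite normrM ler_piMl// ler_norml cos_geN1 cos_le1.
by move: h1; rewrite (_ : ts k + z - ts k = z); [lra|ring].
Qed.

(** The defect of homogeneity splits into three terms that each carry a factor [1 - s], with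
    constants 1, 1 and 2. *)
Lemma norm_phi_scale k s z : 0 <= s <= 1 ->
  `|phi G thetas k (s * z) - s * phi G thetas k z| <= 4 * (1 - s) * `|z|.
Proof.
move=> /andP[s0 s1].
have -> : phi G thetas k (s * z) - s * phi G thetas k z
  = (sin (ts k + s * z) - sin (ts k + z)) + cos (ts k) * ((1 - s) * z)
    + (1 - s) * phi G thetas k z by rewrite /phi; ring.
have h0 : `|(1 - s) * z| = (1 - s) * `|z|.
  by rewrite normrM ger0_norm// subr_ge0.
have h1 : `|sin (ts k + s * z) - sin (ts k + z)| <= (1 - s) * `|z|.
  rewrite -h0 distrC (_ : (1 - s) * z = (ts k + z) - (ts k + s * z)); last by ring.
  exact: norm_sinB.
have h2 : `|cos (ts k) * ((1 - s) * z)| <= (1 - s) * `|z|.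
  by rewrite -h0 normrM ler_piMl// ler_norml cos_geN1 cos_le1.
have h3 : `|(1 - s) * phi G thetas k z| <= (1 - s) * (2 * `|z|).
  by rewrite normrM ger0_norm ?subr_ge0// ler_wpM2l ?subr_ge0// norm_phi_le.
apply: le_trans (ler_normD _ _) _.
by have := ler_normD (sin (ts k + s * z) - sin (ts k + z)) (cos (ts k) * ((1 - s) * z)); lra.
Qed.

(** The first factor is [z] minus a sine increment of size at most [|z|]. Hence the upper sector
    bound holds for every [z], not only on the constraint set. *)
Lemma lure_gradient_sign k z :
  0 <= (sector_up G thetas k * z - phi G thetas k z) * z.
Proof.
have -> : sector_up G thetas k * z - phi G thetas k z
  = z - (sin (ts k + z) - sin (ts k)) by rewrite /sector_up /phi; ring.
have := norm_sinB (ts k + z) (ts k).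
rewrite (_ : ts k + z - ts k = z); last by ring.
have [z0|z0] := leP 0 z; rewrite ler_norml ?(ger0_norm z0) ?(ltr0_norm z0).
  by move=> /andP[_ h]; rewrite mulr_ge0// subr_ge0.
by move=> /andP[h _]; rewrite mulr_le0// ?(ltW z0)// ; lra.
Qed.

Lemma lure_potential_scale k s z : 0 <= s <= 1 ->
  lure_potential k (s * z) <= lure_potential k z.
Proof.
move=> /andP[s0]; rewrite le_eqVlt => /predU1P[->|s1]; first by rewrite mul1r.
have hid (t : R) : is_derive t 1 (fun t : R => t * z) z.
  have := is_derive_ptM (is_derive_pt_id t) (is_derive_pt_cst z t).
  by move=> /is_derive_eq; apply; rewrite mul1r mulr0 addr0.
pose f (t : R) := lure_potential k (t * z).
have df (t : R) : is_derive t 1 f ((sector_up G thetas k * (t * z) - phi G thetas k (t * z)) * z).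
  exact: (is_derive_pt_comp (g := fun t => t * z) (is_derive_lure_potential k (t * z)) (hid t)).
have cf : continuous f.
  by move=> t; exact: is_derive_pt_cont (df t).
have [c /andP[sc _]] := MVT_pos cf (fun t _ => df t) s0 s1.
rewrite /f mul1r => e; rewrite -subr_ge0 e mulr_ge0// ?subr_ge0 ?(ltW s1)//.
have c0 : 0 < c by exact: le_lt_trans sc.
by rewrite -(pmulr_rge0 _ c0) mulrCA lure_gradient_sign.
Qed.

Definition sector_defect (delta_low : 'I_m -> R) k z : R :=
  (phi G thetas k z - delta_low k * z) * (sector_up G thetas k * z - phi G thetas k z).

Lemma continuous_sector_defect delta_low k : continuous (sector_defect delta_low k).
Proof.
move=> z.
have clin (a : R) : a * x @[x --> z] --> a * z by apply: cvgM; [exact: cvg_cst|exact: cvg_id].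
by apply: cvgM; apply: cvgB => //; exact: continuous_phi.
Qed.

(* On an interval where the defect vanishes, [sin] would be affine; second
   differences then force it to vanish at two nearby points. *)
Lemma sector_defect_neq0 delta_low k a b : a < b ->
  exists2 c, a < c < b & sector_defect delta_low k c != 0.
Proof.
move=> ab; apply: contrapT => nex.
have q0 c : a < c < b -> sector_defect delta_low k c = 0.
  by move=> cab; apply/eqP/negP => /negP cN0; apply: nex; exists c.
have sin_lt (d : R) : 0 < d -> d <= 1 -> 0 < sin d.
  move=> d0 d1; apply: sin_gt0_pi; rewrite d0/=; apply: le_lt_trans d1 _.
  by have := pi_ge2 R; lra.
(* Four equally spaced points give two second differences. They avoid 0, where the defect vanishes
   trivially, and [d <= 1] ensures [sin d > 0]. *)
have [p [d [d0 d1 pd0 pd]]] : exists p d, [/\ 0 < d, d <= 1,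
    forall i : nat, (i < 4)%N -> p + i%:R * d != 0 &
    forall i : nat, (i < 4)%N -> a < p + i%:R * d < b].
  have [p [e [e0 e1 H]]] : exists p e, [/\ 0 < e, e <= 1 &
      forall s, p <= s < p + e -> s != 0 /\ a < s < b].
    have [b0|b0] := leP b 0.
      exists ((a + b) / 2), (Num.min 1 ((b - a) / 2)); rewrite ge_min lexx; split => //.
        by rewrite lt_min ltr01/=; lra.
      move=> s /andP[ps]; have : Num.min 1 ((b - a) / 2) <= (b - a) / 2 by rewrite ge_min lexx orbT.
      by move=> h1 h2; split; [rewrite lt_eqF//; lra|apply/andP; split; lra].
    pose p := (Num.max a 0 + b) / 2.
    have a0b : Num.max a 0 < b by rewrite gt_max ab b0.
    have h1 : a <= Num.max a 0 by rewrite le_max lexx.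
    have h2 : 0 <= Num.max a 0 by rewrite le_max lexx orbT.
    exists p, (Num.min 1 (b - p)); rewrite ge_min lexx; split => //.
      by rewrite lt_min ltr01/= /p; lra.
    move=> s /andP[ps]; have : Num.min 1 (b - p) <= b - p by rewrite ge_min lexx orbT.
    by rewrite /p in ps *; move=> h3 h4; split; [rewrite gt_eqF//; lra|apply/andP; split; lra].
  exists p, (e / 4); split; [lra|lra|..] => i i4; apply H; apply/andP; split.
  - by rewrite lerDl mulr_ge0//; lra.
  - rewrite ltrD2l; have : i%:R <= 3%:R :> R by rewrite ler_nat.
    by move=> i3; apply: le_lt_trans (_ : 3%:R * (e / 4) < _); [rewrite ler_wpM2r//; lra|lra].
  - by rewrite lerDl mulr_ge0//; lra.
  - rewrite ltrD2l; have : i%:R <= 3%:R :> R by rewrite ler_nat.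
    by move=> i3; apply: le_lt_trans (_ : 3%:R * (e / 4) < _); [rewrite ler_wpM2r//; lra|lra].
pose v := delta_low k + cos (ts k).
(* At a nonzero point the upper factor of the defect cannot vanish, by [sinDB_eq_id], so the lower
   one does. *)
have affine i : (i < 4)%N -> sin (ts k + (p + i%:R * d)) = sin (ts k) + v * (p + i%:R * d).
  move=> i4; have := q0 _ (pd i i4); have := pd0 i i4.
  set c := p + _ => c0 /eqP.
  rewrite mulf_eq0 => /orP[/eqP h|/eqP h]; first by move: h; rewrite /phi /v; lra.
  have c0' : sin (ts k + c) - sin (ts k) = c by move: h; rewrite /phi /sector_up; lra.
  by rewrite (sinDB_eq_id c0') eqxx in c0.
have sd : 0 < sin d by exact: sin_lt.
have cosd : cos d - 1 != 0.
  apply/negP; rewrite subr_eq0 => /eqP cd1.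
  have : sin d ^+ 2 = 0 by rewrite sin2cos2 cd1; ring.
  by apply/eqP; rewrite sqrf_eq0 gt_eqF.
(* The second difference of the sine at [q] is [2 sin q (cos d - 1)], whereas that of an affine
   function is 0. *)
have mid i : (i < 2)%N -> sin (ts k + (p + i.+1%:R * d)) = 0.
  move=> i2; set q := ts k + _.
  have e1 : sin (q - d) = sin (ts k) + v * (p + i%:R * d).
    rewrite -affine; last exact: ltn_trans i2 _.
    by congr sin; rewrite /q -natr1; ring.
  have e2 : sin q = sin (ts k) + v * (p + i.+1%:R * d).
    by rewrite affine//; exact: leq_ltn_trans i2 _.
  have e3 : sin (q + d) = sin (ts k) + v * (p + i.+2%:R * d).
    rewrite -affine; last by rewrite !ltnS.
    by congr sin; rewrite /q -!natr1; ring.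
  have : sin q * (cos d - 1) * 2 = 0.
    rewrite (_ : _ * 2 = sin (q + d) + sin (q - d) - 2 * sin q).
      by rewrite e1 e2 e3 -!natr1; ring.
    by rewrite sinD sinB; ring.
  move=> /eqP; rewrite mulf_eq0 pnatr_eq0 orbF mulf_eq0 (negbTE cosd) orbF.
  by move=> /eqP.
(* Zeros of the sine at distance [d] with [sin d > 0] make the cosine vanish at the first of them
   too. *)
have m0 := mid 0%N isT; have := mid 1%N isT.
rewrite (_ : ts k + (p + 2%:R * d) = ts k + (p + 1%:R * d) + d); last by ring.
rewrite sinD m0 mul0r add0r => /eqP; rewrite mulf_eq0 (gt_eqF sd) orbF => /eqP c0.
have := cos2Dsin2 (ts k + (p + 1%:R * d)); rewrite m0 c0 expr0n/= addr0 => /eqP.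
by rewrite eq_sym oner_eq0.
Qed.

End SectorNonlinearity.

(** * Linear algebra of the network *)

Section DotProduct.
Variable R : realType.

Definition dotcv (N : nat) (u v : 'cV[R]_N) : R := (u^T *m v) 0 0.

Lemma dotcvE N (u v : 'cV[R]_N) : dotcv u v = \sum_i u i 0 * v i 0.
Proof. by rewrite /dotcv mxE; apply: eq_bigr => i _; rewrite mxE. Qed.

Lemma dotcvC N (u v : 'cV[R]_N) : dotcv u v = dotcv v u.
Proof. by rewrite !dotcvE; apply: eq_bigr => i _; rewrite mulrC. Qed.

Lemma dotcvDr N (u v w : 'cV[R]_N) : dotcv u (v + w) = dotcv u v + dotcv u w.
Proof. by rewrite /dotcv mulmxDr mxE. Qed.

Lemma dotcvNr N (u v : 'cV[R]_N) : dotcv u (- v) = - dotcv u v.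
Proof. by rewrite /dotcv mulmxN mxE. Qed.

Lemma dotcvZr N (u v : 'cV[R]_N) a : dotcv u (a *: v) = a * dotcv u v.
Proof. by rewrite /dotcv -scalemxAr mxE. Qed.

Lemma dotcvDl N (u v w : 'cV[R]_N) : dotcv (v + w) u = dotcv v u + dotcv w u.
Proof. by rewrite dotcvC dotcvDr !(dotcvC u). Qed.

Lemma dotcvNl N (u v : 'cV[R]_N) : dotcv (- v) u = - dotcv v u.
Proof. by rewrite dotcvC dotcvNr dotcvC. Qed.

Lemma dotcvZl N (u v : 'cV[R]_N) a : dotcv (a *: v) u = a * dotcv v u.
Proof. by rewrite dotcvC dotcvZr dotcvC. Qed.

Lemma dotcv_mull N K (A : 'M[R]_(K, N)) u v : dotcv (A *m u) v = dotcv u (A^T *m v).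
Proof. by rewrite /dotcv trmx_mul mulmxA. Qed.

Lemma dotcv_col_mx N K (u1 v1 : 'cV[R]_N) (u2 v2 : 'cV[R]_K) :
  dotcv (col_mx u1 u2) (col_mx v1 v2) = dotcv u1 v1 + dotcv u2 v2.
Proof. by rewrite /dotcv tr_col_mx mul_row_col mxE. Qed.

Lemma diagf_mulE N (d : 'I_N -> R) (v : 'cV[R]_N) i : (diagf d *m v) i 0 = d i * v i 0.
Proof. by rewrite mul_diag_mx !mxE. Qed.

Lemma dotcv_diagf N (d : 'I_N -> R) (u v : 'cV[R]_N) :
  dotcv u (diagf d *m v) = \sum_i d i * (u i 0 * v i 0).
Proof. by rewrite dotcvE; apply: eq_bigr => i _; rewrite diagf_mulE mulrCA. Qed.

Lemma trmx_diagf N (d : 'I_N -> R) : (diagf d)^T = diagf d.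
Proof. exact: tr_diag_mx. Qed.

Lemma diagf_unitmx N (d : 'I_N -> R) : (forall i, 0 < d i) -> diagf d \in unitmx.
Proof.
move=> d0; suff : diagf d *m diagf (fun i => (d i)^-1) = 1%:M.
  by move=> /mulmx1_unit[].
by rewrite mulmx_diag; apply/matrixP => i j; rewrite !mxE divff// gt_eqF.
Qed.

End DotProduct.

Section Network.
Variables (R : realType) (n m : nat) (G : power_network R n m).
Local Notation E := (incidence G).
Local Notation ld := (line_diff G).
Implicit Types (v : 'cV[R]_n) (k : 'I_m).

Lemma line_diff0 k : ld 0 k = 0.
Proof. by rewrite -incidence_trE mulmx0 mxE. Qed.

Lemma line_diffZ a v k : ld (a *: v) k = a * ld v k.
Proof. by rewrite -!incidence_trE -scalemxAr mxE. Qed.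

Lemma line_diffD v w k : ld (v + w) k = ld v k + ld w k.
Proof. by rewrite -!incidence_trE mulmxDr mxE. Qed.

(** The nodal values agree along every path, and connectedness links each generator to the infinite
    bus, whose value is 0. *)
Lemma line_diff_eq0 v : (forall k, ld v k = 0) -> v = 0.
Proof.
move=> v0.
have conn (a b : option 'I_n) : nodal v a = nodal v b.
  have /connectP[p] := network_connected G a b.
  elim: p a => [a _ -> //|c p IH a /= /andP[/existsP[k hk] cp] bE].
  rewrite -(IH c cp bE); have /eqP := v0 k; rewrite subr_eq0 => /eqP e.
  by case/orP: hk => /andP[/eqP <- /eqP <-].
by apply/colP => i; rewrite mxE; exact: (conn (Some i) None).
Qed.

Lemma line_diff_left_inverse : exists F : 'M[R]_(n, m),
  forall v i, v i 0 = \sum_k F i k * ld v k.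
Proof.
have /row_freeP[B EB] : row_free E.
  apply: inj_row_free => v vE; apply: trmx_inj; rewrite trmx0.
  apply: line_diff_eq0 => k; rewrite -incidence_trE -trmx_mul vE.
  by rewrite trmx0 mxE.
exists B^T => v i.
have : B^T *m (E^T *m v) = v by rewrite mulmxA -trmx_mul EB trmx1 mul1mx.
move=> {1}<-; rewrite mxE; apply: eq_bigr => k _.
by rewrite incidence_trE.
Qed.

(* Raising one end of line [k] by [pi / 2], all other nodes being at angle 0. *)
Lemma line_diff_pihalf k : exists v,
  `|ld v k| = pi / 2 /\ forall j, `|ld v j| <= pi / 2.
Proof.
have pi2 : 0 <= pi / 2 :> R by rewrite divr_ge0 ?pi_ge0.
have nodE (i0 : 'I_n) a : nodal (\col_i (pi / 2 *+ (i == i0))) a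
    = (pi / 2) *+ (a == Some i0) :> R.
  by case: a => [i|]//=; rewrite mxE (inj_eq Some_inj).
(* The two ends of a line differ, so at least one of them is a generator. *)
have [i0 hi0] : exists i0, (src G k == Some i0) != (dst G k == Some i0).
  case e1 : (src G k) => [i|]; [exists i|case e2 : (dst G k) => [i|]; [exists i|]].
  - by rewrite eqxx -e1 eq_sym; have := src_neq_dst G k; rewrite eq_sym => /negbTE ->.
  - by rewrite eqxx.
  - by have := src_neq_dst G k; rewrite e1 e2 eqxx.
exists (\col_i (pi / 2 *+ (i == i0))); rewrite /line_diff; split => [|j].
  rewrite !nodE; case: (src G k == _) hi0; case: (dst G k == _) => //= _.
    by rewrite mulr0n subr0 ger0_norm.
  by rewrite mulr0n sub0r normrN ger0_norm.
rewrite !nodE; case: (src G j == _); case: (dst G j == _) => /=;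
  by rewrite ?subrr ?subr0 ?sub0r ?normrN ?normr0 ?(ger0_norm pi2).
Qed.

End Network.

Section LureDynamics.
Variables (R : realType) (n m : nat) (G : power_network R n m).
Variable thetas : 'cV[R]_n.
Local Notation E := (incidence G).
Local Notation ld := (line_diff G).
Local Notation ts := (line_diff G thetas).
Local Notation f := (lure_field G thetas).
Local Notation A := (lure_A G thetas).
Local Notation B := (lure_B G).
Local Notation C := (lure_C G).
Implicit Types (x w : 'cV[R]_(n + n)) (k : 'I_m).

(** This is [z_k]; along a trajectory, [line_freq] is its time derivative. *)
Definition line_dev x k : R := ld (usubmx x) k.
Definition line_freq x k : R := ld (dsubmx x) k.

Lemma lure_CE x k : (C *m x) k 0 = line_dev x k.
Proof.
by rewrite -{1}(vsubmxK x) mul_row_col mul0mx addr0 incidence_trE.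
Qed.

Lemma phi_vecE x k : phi_vec G thetas (C *m x) k 0 = phi G thetas k (line_dev x k).
Proof. by rewrite mxE lure_CE. Qed.

Lemma line_diff_angle x k : ld (angle_of thetas x) k = ts k + line_dev x k.
Proof. by rewrite line_diffD addrC. Qed.

(** The nonlinearity acts on accelerations while the output reads angles, so the velocity of [z]
    does not involve [phi]. *)
Lemma lure_CB0 : C *m B = 0.
Proof. by rewrite mul_row_col mulmx0 mul0mx addr0. Qed.

Lemma usubmx_lure_field x : usubmx (f x) = dsubmx x.
Proof.
rewrite /lure_field -{1}(vsubmxK x) mul_block_col mul_col_mx.
by rewrite opp_col_mx add_col_mx col_mxKu mul0mx mul1mx mul0mx subr0 add0r.
Qed.

Definition sin_dev x : 'cV[R]_m := \col_k (sin (ts k + line_dev x k) - sin (ts k)).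

(** The cosine term of [lure_A] cancels the linear part of [phi], leaving the swing equation. *)
Lemma dsubmx_lure_field x : inertia_mx G *m dsubmx (f x)
  = - (E *m line_mx G *m sin_dev x + damping_mx G *m dsubmx x).
Proof.
have Mu : inertia_mx G \in unitmx by apply: diagf_unitmx; exact: inertia_gt0.
rewrite /lure_field -{1}(vsubmxK x) mul_block_col mul_col_mx.
rewrite opp_col_mx add_col_mx col_mxKd.
rewrite -!mulmxA !mulNmx -!mulmxA -opprD -opprD mulmxN; congr (- _).
rewrite !mulmxDr !mulKVmx// addrAC; congr (_ + _).
rewrite -!mulmxDr; congr (_ *m (_ *m _)).
apply/colP => k; rewrite mxE diagf_mulE incidence_trE phi_vecE [RHS]mxE /phi.
by rewrite -/(line_dev x k); ring.
Qed.

Lemma line_dev_lure_field x k : line_dev (f x) k = line_freq x k.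
Proof. by rewrite /line_dev usubmx_lure_field. Qed.

Variables (delta_low : 'I_m -> R) (P : 'M[R]_(n + n)) (lambda : 'I_m -> R).
Variable Gamma : 'M[R]_m.
Local Notation V := (lyapunov G thetas P lambda).

Lemma lyapunovE x : V x = dotcv x (P *m x)
  + 2 * \sum_k lambda k * lure_potential G thetas k (line_dev x k).
Proof.
rewrite /lyapunov /dotcv mulmxA; congr (_ + 2 * _).
by apply: eq_bigr => k _; rewrite lure_potentialE lure_CE.
Qed.

(** For symmetric [P], the derivative of [V] at [x] in the direction [w]. *)
Definition lyapunov_diff x w : R := 2 * dotcv x (P *m w)
  + 2 * \sum_k lambda k *
      ((sector_up G thetas k * line_dev x k - phi G thetas k (line_dev x k)) * line_dev w k).

(** The S-procedure as an identity: [lmi_R] is the matrix of the quadratic form obtained by adding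
    the [Gamma]-weighted sector defects to the derivative of [V], with [x] and [phi] taken as
    independent variables. *)
Lemma lyapunov_diff_field (Psym : P^T = P) (Gamma_diag : is_diag_mx Gamma) x :
  let v := col_mx x (phi_vec G thetas (C *m x)) in
  lyapunov_diff x (f x) = dotcv v (lmi_R G thetas delta_low P lambda Gamma *m v)
   - 2 * \sum_k Gamma k k * sector_defect G thetas delta_low k (line_dev x k).
Proof.
move=> v.
have GE : Gamma = diagf (fun k => Gamma k k).
  apply/matrixP => i j; rewrite !mxE; case: eqVneq => [->|ij]; first by rewrite mulr1n.
  by have /is_diag_mxP := Gamma_diag => ->.
set Z := C *m x; set Phi := phi_vec G thetas Z.
have ZE k : Z k 0 = line_dev x k by exact: lure_CE.
have PhiE k : Phi k 0 = phi G thetas k (line_dev x k) by exact: phi_vecE.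
have subE (u w : 'cV[R]_m) k : (u - w) k 0 = u k 0 - w k 0 by rewrite !mxE.
pose L := diagf lambda; pose Dl := diagf delta_low; pose Du := diagf (sector_up G thetas).
(* By [lure_CB0] only the linear part [A x] of the field contributes to the velocity of [z]. *)
have e1 : \sum_k lambda k * ((sector_up G thetas k * line_dev x k
      - phi G thetas k (line_dev x k)) * line_dev (f x) k)
    = dotcv (Du *m Z - Phi) (L *m (C *m (A *m x))).
  rewrite dotcv_diagf; apply: eq_bigr => k _.
  rewrite subE PhiE diagf_mulE ZE; congr (_ * (_ * _)).
  by rewrite -lure_CE /lure_field mulmxBr (mulmxA C B) lure_CB0 mul0mx subr0.
have e2 : \sum_k Gamma k k * sector_defect G thetas delta_low k (line_dev x k)
    = dotcv (Phi - Dl *m Z) (Gamma *m (Du *m Z - Phi)).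
  rewrite GE dotcv_diagf; apply: eq_bigr => k _; rewrite -GE /sector_defect.
  by rewrite !subE !diagf_mulE PhiE ZE.
rewrite /lyapunov_diff e1 e2 /v /lmi_R -/L -/Dl -/Du mul_block_col dotcv_col_mx -/Phi.
rewrite /lure_field -/Z -/Phi.
have GT : Gamma^T = Gamma by rewrite GE trmx_diagf.
have LT : L^T = L by exact: trmx_diagf.
have DlT : Dl^T = Dl by exact: trmx_diagf.
have DuT : Du^T = Du by exact: trmx_diagf.
set R12 := - (P *m B) - _ + _; set w := A *m x.
have -> : dotcv Phi (R12^T *m x + - (2 *: Gamma) *m Phi)
    = dotcv x (R12 *m Phi) - 2 * dotcv Phi (Gamma *m Phi).
  by rewrite dotcvDr -dotcv_mull dotcvC mulNmx dotcvNr -scalemxAl dotcvZr.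
have symM N (M : 'M[R]_N) (MT : M^T = M) u u' : dotcv (M *m u) u' = dotcv u (M *m u').
  by rewrite dotcv_mull MT.
have e12 : dotcv x (R12 *m Phi) = - dotcv x (P *m (B *m Phi)) - dotcv Phi (L *m (C *m w))
    + dotcv (Dl *m Z) (Gamma *m Phi) + dotcv (Du *m Z) (Gamma *m Phi).
  rewrite /R12 !mulmxDl !mulNmx -!mulmxA !dotcvDr !dotcvNr.
  rewrite -(dotcv_mull A) -(dotcv_mull C) -(dotcv_mull C) -/w -/Z.
  rewrite mulmxDl dotcvDr -(symM _ Dl DlT) -(symM _ Du DuT) addrA.
  by rewrite (dotcvC (C *m w)) (symM _ L LT).
have e11 : dotcv x ((A^T *m (P + C^T *m L *m Du *m C) + (P + C^T *m Du *m L *m C) *m A -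
      2 *: (C^T *m Dl *m Gamma *m Du *m C)) *m x)
    = 2 * dotcv x (P *m w) + 2 * dotcv (Du *m Z) (L *m (C *m w))
      - 2 * dotcv (Dl *m Z) (Gamma *m (Du *m Z)).
  rewrite !mulmxDl mulNmx !mulmxDr !mulmxDl -scalemxAl -!mulmxA -/w -/Z.
  rewrite !dotcvDr dotcvNr dotcvZr.
  rewrite -!(dotcv_mull A) -!(dotcv_mull C) -/w -/Z.
  rewrite (dotcvC w) (symM _ P Psym) (dotcvC (C *m w)) (symM _ L LT).
  by rewrite -(symM _ Du DuT) -(symM _ Dl DlT); ring.
rewrite dotcvDr e11 e12 mulmxBr !dotcvDr !dotcvDl !dotcvNr !dotcvNl.
rewrite !mulmxBr !dotcvDr !dotcvNr.
rewrite -(symM _ Gamma GT Phi (Du *m Z)) (dotcvC (Gamma *m Phi)); ring.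
Qed.
End LureDynamics.

(** * Calculus along paths *)

Section PathCalculus.
Variable R : realType.

Lemma cvg_sum_pt (I : finType) {T : Type} (F : set_system T) {FF : Filter F}
    (u : I -> T -> R) (l : I -> R) :
  (forall i, u i t @[t --> F] --> l i) ->
  \sum_i u i t @[t --> F] --> \sum_i l i.
Proof.
by move=> ul; apply: cvg_big => [|i _]; [exact: add_continuous|exact: ul].
Qed.

Lemma cvg_colP {T : Type} (F : set_system T) {FF : Filter F} N
    (y : T -> 'cV[R]_N) (l : 'cV[R]_N) :
  (forall i, y t i 0 @[t --> F] --> l i 0) -> y t @[t --> F] --> l.
Proof.
move=> yl A [P /= Pl PA].
have : \forall t \near F, forall i, P i 0 (y t i 0).
  apply: (@filter_forall _ _ (fun i t => P i 0 (y t i 0)) F _) => i.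
  exact: (yl i _ (Pl i 0)).
by apply: filterS => t Pt; apply: PA => i j; rewrite !ord1.
Qed.

Lemma cvg_mulmx {T : Type} (F : set_system T) {FF : Filter F} K N
    (M : 'M[R]_(K, N)) (y : T -> 'cV[R]_N) (l : 'cV[R]_N) :
  (forall i, y t i 0 @[t --> F] --> l i 0) ->
  forall i, (M *m y t) i 0 @[t --> F] --> (M *m l) i 0.
Proof.
move=> yl i; rewrite mxE.
rewrite (_ : (fun t => _) = (fun t => \sum_j M i j * y t j 0)); last first.
  by apply/funext => t; rewrite mxE.
by apply: cvg_sum_pt => j; apply: cvgM => //; exact: cvg_cst.
Qed.

Lemma cvg_dotcv {T : Type} (F : set_system T) {FF : Filter F} N
    (y y' : T -> 'cV[R]_N) (l l' : 'cV[R]_N) :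
  (forall i, y t i 0 @[t --> F] --> l i 0) ->
  (forall i, y' t i 0 @[t --> F] --> l' i 0) ->
  dotcv (y t) (y' t) @[t --> F] --> dotcv l l'.
Proof.
move=> yl yl'; rewrite dotcvE.
rewrite (_ : (fun t => _) = (fun t => \sum_j y t j 0 * y' t j 0)); last first.
  by apply/funext => t; rewrite dotcvE.
by apply: cvg_sum_pt => j; exact: cvgM.
Qed.

Lemma is_derive_mulmx K N (M : 'M[R]_(K, N)) (y : R -> 'cV[R]_N) (w : 'cV[R]_N) (t : R) :
  (forall i, is_derive t 1 (fun s => y s i 0) (w i 0)) ->
  forall i, is_derive t 1 (fun s => (M *m y s) i 0) ((M *m w) i 0).
Proof.
move=> dy i; rewrite mxE.
rewrite (_ : (fun s => _) = (fun s => \sum_j M i j * y s j 0)); last first.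
  by apply/funext => s; rewrite mxE.
by apply: is_derive_pt_sum => j; exact: is_derive_ptZ.
Qed.

Lemma is_derive_dotcv N (y y' : R -> 'cV[R]_N) (w w' : 'cV[R]_N) (t : R) :
  (forall i, is_derive t 1 (fun s => y s i 0) (w i 0)) ->
  (forall i, is_derive t 1 (fun s => y' s i 0) (w' i 0)) ->
  is_derive t 1 (fun s => dotcv (y s) (y' s)) (dotcv w (y' t) + dotcv (y t) w').
Proof.
move=> dy dy'; rewrite !dotcvE -big_split/=.
rewrite (_ : (fun s => _) = (fun s => \sum_j y s j 0 * y' s j 0)); last first.
  by apply/funext => s; rewrite dotcvE.
by apply: is_derive_pt_sum => j; exact: is_derive_ptM.
Qed.

Lemma norm_mulmx_le K N (M : 'M[R]_(K, N)) (v : 'cV[R]_N) (b : 'I_N -> R) :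
  (forall i, `|v i 0| <= b i) ->
  forall i, `|(M *m v) i 0| <= \sum_j `|M i j| * b j.
Proof.
move=> vb i; rewrite mxE; apply: le_trans (ler_norm_sum _ _ _) _.
by apply: ler_sum => j _; rewrite normrM ler_wpM2l.
Qed.

Lemma continuous_extend_left (u : R -> R) : {within `[0, +oo[, continuous u} ->
  continuous (fun t : R => u (Num.max 0 t)).
Proof.
move=> /subspace_continuousP cu t.
have m0 (s : R) : `[0, +oo[%classic (Num.max 0 s).
  by rewrite /= in_itv/= andbT le_max lexx.
have cm : Num.max 0 s @[s --> t] --> Num.max 0 t.
  by apply: (@continuous_max R R (cst 0) id t); [exact: cvg_cst|exact: cvg_id].
move=> A /(cu _ (m0 t)) /cm h.
by apply: (@filterS _ (nbhs t) _ _ _ _ h) => s; apply; exact: m0.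
Qed.

(** A negative derivative at [b] would be negative just before [b] too, and [u] would have been
    larger there. *)
Lemma left_max_derive_ge0 (u du : R -> R) (a b : R) : continuous u ->
  (forall t : R, 0 < t -> is_derive t 1 u (du t)) -> du @ b --> du b ->
  0 <= a -> a < b -> (forall t, a <= t <= b -> u t <= u b) -> 0 <= du b.
Proof.
move=> cu ud cdu a0 ab umax; rewrite leNgt; apply/negP => dneg.
have : \forall s \near b, du s < 0 by exact: (cvgr_lt (du b) cdu _ dneg).
move=> /near_ball_lt[e e0 He].
pose a' := Num.max a (b - e / 2).
have aa' : a <= a' by rewrite le_max lexx.
have ba' : b - e / 2 <= a' by rewrite le_max lexx orbT.
have a'b : a' < b by rewrite gt_max ab/=; lra.
have [c /andP[ac cb] ec] := MVT_pos cu ud (le_trans a0 aa') a'b.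
have /He dc : `|c - b| < e by rewrite ltr_norml; apply/andP; split; lra.
have : u a' <= u b by apply: umax; rewrite aa' ltW.
by rewrite -subr_ge0 ec leNgt nmulr_rlt0 ?subr_gt0// a'b.
Qed.

End PathCalculus.

Section LureCalculus.
Variables (R : realType) (n m : nat) (G : power_network R n m).
Variable thetas : 'cV[R]_n.
Variables (P : 'M[R]_(n + n)) (lambda : 'I_m -> R).
Local Notation V := (lyapunov G thetas P lambda).
Local Notation f := (lure_field G thetas).
Local Notation DV := (lyapunov_diff G thetas P lambda).
Local Notation dev := (line_dev G).
Implicit Types (k : 'I_m).

Lemma cvg_line_dev {T : Type} (F : set_system T) {FF : Filter F}
    (y : T -> 'cV[R]_(n + n)) (l : 'cV[R]_(n + n)) :
  (forall i, y t i 0 @[t --> F] --> l i 0) ->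
  forall k, dev (y t) k @[t --> F] --> dev l k.
Proof.
move=> yl k; rewrite -lure_CE.
rewrite (_ : (fun t => _) = (fun t => (lure_C G *m y t) k 0)).
  exact: cvg_mulmx.
by apply/funext => t; rewrite lure_CE.
Qed.

Lemma cvg_lyapunov {T : Type} (F : set_system T) {FF : Filter F}
    (y : T -> 'cV[R]_(n + n)) (l : 'cV[R]_(n + n)) :
  (forall i, y t i 0 @[t --> F] --> l i 0) -> V (y t) @[t --> F] --> V l.
Proof.
move=> yl; rewrite lyapunovE.
rewrite (_ : (fun t => _) = (fun t => dotcv (y t) (P *m y t)
   + 2 * \sum_k lambda k * lure_potential G thetas k (dev (y t) k))); last first.
  by apply/funext => t; rewrite lyapunovE.
apply: cvgD; first by apply: cvg_dotcv => //; exact: cvg_mulmx.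
apply: cvgM; first exact: cvg_cst.
apply: cvg_sum_pt => k; apply: cvgM; first exact: cvg_cst.
have cpot := is_derive_pt_cont (is_derive_lure_potential G thetas k (dev l k)).
exact: (cvg_comp (fun t => dev (y t) k) _ (cvg_line_dev (k := k) yl) cpot).
Qed.

Lemma cvg_lure_field {T : Type} (F : set_system T) {FF : Filter F}
    (y : T -> 'cV[R]_(n + n)) (l : 'cV[R]_(n + n)) :
  (forall i, y t i 0 @[t --> F] --> l i 0) ->
  forall i, f (y t) i 0 @[t --> F] --> f l i 0.
Proof.
move=> yl i; have subE (u w : 'cV[R]_(n + n)) : (u - w) i 0 = u i 0 - w i 0 by rewrite !mxE.
rewrite /lure_field subE.
rewrite (_ : (fun t => _) = (fun t => (lure_A G thetas *m y t) i 0
  - (lure_B G *m phi_vec G thetas (lure_C G *m y t)) i 0)); last first.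
  by apply/funext => t; rewrite subE.
apply: cvgB; first exact: cvg_mulmx.
apply: cvg_mulmx => k; rewrite phi_vecE.
rewrite (_ : (fun t => _) = (fun t => phi G thetas k (dev (y t) k))).
  exact: (cvg_comp (fun t => dev (y t) k) _ (cvg_line_dev (k := k) yl)
    (@continuous_phi _ _ _ G thetas k (dev l k))).
by apply/funext => t; rewrite phi_vecE.
Qed.

Lemma is_derive_line_dev (y : R -> 'cV[R]_(n + n)) (w : 'cV[R]_(n + n)) (t : R) :
  (forall i, is_derive t 1 (fun s => y s i 0) (w i 0)) ->
  forall k, is_derive t 1 (fun s => dev (y s) k) (dev w k).
Proof.
move=> dy k; rewrite -lure_CE.
rewrite (_ : (fun s => _) = (fun s => (lure_C G *m y s) k 0)).
  exact: is_derive_mulmx.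
by apply/funext => s; rewrite lure_CE.
Qed.

Lemma is_derive_lyapunov (y : R -> 'cV[R]_(n + n)) (w : 'cV[R]_(n + n)) (t : R) : P^T = P ->
  (forall i, is_derive t 1 (fun s => y s i 0) (w i 0)) ->
  is_derive t 1 (fun s => V (y s)) (DV (y t) w).
Proof.
move=> Psym dy.
rewrite (_ : (fun s => _) = (fun s => dotcv (y s) (P *m y s)
   + 2 * \sum_k lambda k * lure_potential G thetas k (dev (y s) k))); last first.
  by apply/funext => s; rewrite lyapunovE.
have -> : DV (y t) w = (dotcv w (P *m y t) + dotcv (y t) (P *m w))
    + 2 * \sum_k lambda k * ((sector_up G thetas k * dev (y t) k
      - phi G thetas k (dev (y t) k)) * dev w k).
  by rewrite /lyapunov_diff dotcvC dotcv_mull Psym; ring.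
apply: is_derive_ptD; first by apply: is_derive_dotcv => //; exact: is_derive_mulmx.
apply: is_derive_ptZ; apply: is_derive_pt_sum => k; apply: is_derive_ptZ.
apply: (@is_derive_pt_comp _ (lure_potential G thetas k)); last exact: is_derive_line_dev.
exact: is_derive_lure_potential.
Qed.

End LureCalculus.

(** * Region of attraction *)

Section RegionOfAttraction.
Variables (R : realType) (n m : nat) (G : power_network R n m).
Variables (thetas : 'cV[R]_n) (theta_bar : 'I_m -> R) (omega_bar : 'I_n -> R).
Variables (delta_low : 'I_m -> R) (P : 'M[R]_(n + n)) (lambda : 'I_m -> R).
Variable Gamma : 'M[R]_m.
Hypothesis thetas_lt : forall k, `|line_diff G thetas k| < pi / 2.
Hypothesis P2_sub : constraint_P2 G thetas `<=` constraint_P G thetas theta_bar.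
Hypothesis P_sub : constraint_P G thetas theta_bar `<=` constraint_P1 G thetas.
Hypothesis omega_bar_gt0 : forall i, 0 < omega_bar i.
Hypothesis sector : sector_bounds G thetas theta_bar delta_low.
Hypothesis P_posdef : posdefmx P.
Hypothesis lambda_ge0 : forall k, 0 <= lambda k.
Hypothesis Gamma_diag : is_diag_mx Gamma.
Hypothesis Gamma_posdef : posdefmx Gamma.
Hypothesis R_le0 : le_semidef (lmi_R G thetas delta_low P lambda Gamma) 0.

Local Notation V := (lyapunov G thetas P lambda).
Local Notation f := (lure_field G thetas).
Local Notation DV := (lyapunov_diff G thetas P lambda).
Local Notation dev := (line_dev G).
Local Notation ts := (line_diff G thetas).
Local Notation Pc := (constraint_P G thetas theta_bar).
Local Notation Sc := (constraint_S omega_bar).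
Local Notation X := (roa_estimate G thetas V theta_bar omega_bar).
Local Notation defect := (sector_defect G thetas delta_low).
Implicit Types (k : 'I_m) (x y : 'cV[R]_(n + n)).

(** * Geometry of the constraint set around the equilibrium *)

Lemma constraint_PE x : Pc x <-> forall k, `|ts k + dev x k| <= theta_bar k.
Proof. by split=> Px k; have := Px k; rewrite line_diff_angle. Qed.

(** A state with the angle difference of line [k] at [pi / 2] in size lies in [P_2], hence in the
    constraint set, so [theta_bar k >= pi / 2]. *)
Lemma theta_bar_gt k : `|ts k| < theta_bar k.
Proof.
have [v [vk vle]] := line_diff_pihalf G k.
apply: lt_le_trans (thetas_lt k) _; rewrite -vk.
have : Pc (state thetas v 0).
  apply: P2_sub => j; rewrite -!ler_norml (ltW (thetas_lt j)).
  by rewrite /angle_of /state col_mxKu subrK.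
by move=> /(_ k); rewrite /angle_of /state col_mxKu subrK.
Qed.

Lemma line_devZ a x k : dev (a *: x) k = a * dev x k.
Proof. by rewrite /line_dev linearZ line_diffZ. Qed.

Lemma line_dev0 k : dev 0 k = 0.
Proof. by rewrite /line_dev linear0 line_diff0. Qed.

Lemma line_freqZ a x k : line_freq G (a *: x) k = a * line_freq G x k.
Proof. by rewrite /line_freq linearZ line_diffZ. Qed.

(* [0] is an interior point of the convex set [Pc]. *)
Lemma scale_interior s x : 0 <= s < 1 -> Pc x ->
  forall k, `|ts k + s * dev x k| < theta_bar k.
Proof.
move=> /andP[s0 s1] /constraint_PE Px k.
have -> : ts k + s * dev x k = (1 - s) * ts k + s * (ts k + dev x k) by ring.
apply: le_lt_trans (ler_normD _ _) _; rewrite !normrM.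
rewrite (ger0_norm s0) (@ger0_norm _ (1 - s)) ?subr_ge0 ?(ltW s1)//.
have h1 : (1 - s) * `|ts k| < (1 - s) * theta_bar k.
  by rewrite ltr_pM2l ?subr_gt0// theta_bar_gt.
have h2 : s * `|ts k + dev x k| <= s * theta_bar k by rewrite ler_wpM2l.
lra.
Qed.

Lemma Gamma_gt0 k : 0 < Gamma k k.
Proof.
have [_ /(_ (delta_mx k 0))] := Gamma_posdef.
have dk0 : delta_mx k 0 != 0 :> 'cV[R]_m.
  by apply/eqP => /matrixP/(_ k 0); rewrite !mxE !eqxx => /eqP; rewrite oner_eq0.
by move=> /(_ dk0); rewrite -mulmxA trmx_delta -rowE -colE !mxE.
Qed.

(** * Decay of [V] along the field and along rays to the origin *)

Lemma phi0 k : phi G thetas k 0 = 0.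
Proof. by rewrite /phi addr0 mulr0 !subrr. Qed.

Lemma sector_defect_ge0 x k : Pc x -> 0 <= defect k (dev x k).
Proof.
move=> Px; rewrite /sector_defect; have [sb _ _ _] := sector.
have [->|z0] := eqVneq (dev x k) 0; first by rewrite phi0 !mulr0 subrr mulr0.
have := sb k x Px; rewrite lure_CE => /(_ z0).
set r := _ / _ => /andP[lo up].
have -> : phi G thetas k (dev x k) = r * dev x k by rewrite /r divfK.
have -> : (r * dev x k - delta_low k * dev x k) * (sector_up G thetas k * dev x k - r * dev x k)
  = (r - delta_low k) * (sector_up G thetas k - r) * dev x k ^+ 2 by ring.
by apply: mulr_ge0; [rewrite mulr_ge0// subr_ge0|exact: sqr_ge0].
Qed.

(** Valid at every state; the constraint set matters only for the sign of the defects. *)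
Lemma lyapunov_decay x : DV x (f x)
  <= - (2 * \sum_k Gamma k k * defect k (dev x k)).
Proof.
have [Psym _] := P_posdef.
rewrite (lyapunov_diff_field G thetas delta_low lambda Psym Gamma_diag).
rewrite -subr_le0 opprK subrK.
have [_ /(_ (col_mx x (phi_vec G thetas (lure_C G *m x))))] := R_le0.
by rewrite sub0r -mulmxA mulNmx mulmxN mxE oppr_ge0.
Qed.

Lemma lyapunov_decay_line x k : Pc x -> DV x (f x)
  <= - (2 * Gamma k k * defect k (dev x k)).
Proof.
move=> Px; apply: le_trans (lyapunov_decay x) _.
rewrite lerN2 -mulrA ler_pM2l// (bigD1 k)//= lerDl sumr_ge0// => j _.
by rewrite mulr_ge0 ?sector_defect_ge0 ?(ltW (Gamma_gt0 j)).
Qed.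

Lemma lyapunov_decay_le0 x : Pc x -> DV x (f x) <= 0.
Proof.
move=> Px; apply: le_trans (lyapunov_decay x) _.
rewrite oppr_le0 mulr_ge0// sumr_ge0// => j _.
by rewrite mulr_ge0 ?sector_defect_ge0 ?(ltW (Gamma_gt0 j)).
Qed.

Lemma dotcv_P_gt0 x : x != 0 -> 0 < dotcv x (P *m x).
Proof. by have [_ H] := P_posdef; move=> /H; rewrite -mulmxA. Qed.

Lemma dotcv_P_ge0 x : 0 <= dotcv x (P *m x).
Proof.
have [->|/dotcv_P_gt0/ltW//] := eqVneq x 0.
by rewrite mulmx0 /dotcv mulmx0 mxE.
Qed.

(** The quadratic part scales by [s ^+ 2 <= s], and the potentials do not increase towards the
    origin. *)
Lemma lyapunov_scale s x : 0 <= s <= 1 ->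
  V (s *: x) <= V x - (1 - s) * dotcv x (P *m x).
Proof.
move=> s01; have /andP[s0 s1] := s01.
rewrite !lyapunovE -scalemxAr dotcvZl dotcvZr.
have h1 : \sum_k lambda k * lure_potential G thetas k (dev (s *: x) k)
    <= \sum_k lambda k * lure_potential G thetas k (dev x k).
  by apply: ler_sum => k _; rewrite ler_wpM2l// line_devZ lure_potential_scale.
have h2 : s * (s * dotcv x (P *m x)) <= s * dotcv x (P *m x).
  by rewrite ler_wpM2l// ler_piMl// dotcv_P_ge0.
lra.
Qed.

Lemma lyapunov_ge0 x : 0 <= V x.
Proof.
rewrite lyapunovE addr_ge0 ?dotcv_P_ge0// mulr_ge0// sumr_ge0// => k _.
rewrite mulr_ge0//.
have := @lure_potential_scale _ _ _ G thetas k 0 (dev x k).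
by rewrite lexx ler01 mul0r /lure_potential addr0 expr0n/= mul0r mulr0 add0r subrr addr0 => ->.
Qed.

(** The sign condition treats both bounds at once: the angle difference, at [theta_bar k] or its
    opposite, is not moving inwards. These are the points over which [Vplus] and [Vminus]
    minimize. *)
Lemma estimate_line_barrier x y k : X x -> Pc y ->
  `|ts k + dev y k| = theta_bar k ->
  0 <= (ts k + dev y k) * line_freq G y k -> V x <= V y.
Proof.
move=> [Vx _] Py yk out.
have tb : 0 < theta_bar k by exact: le_lt_trans (theta_bar_gt k).
rewrite -lee_fin; apply: le_trans Vx _; rewrite /Vmax ge_min; apply/orP; left.
apply: (@bigmin_inf _ _ _ _ k) => //.
rewrite ge_min; move: yk out; have [a0|a0] := leP 0 (ts k + dev y k).
  rewrite ger0_norm// => yk; rewrite yk pmulr_rge0// => out.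
  apply/orP; right; apply: ereal_inf_lbound; exists y => //.
  by split => //; [rewrite line_diff_angle|rewrite -subr_ge0].
rewrite ltr0_norm// => yk; rewrite nmulr_rge0// => out.
apply/orP; left; apply: ereal_inf_lbound; exists y => //.
by split => //; [rewrite line_diff_angle -yk opprK|rewrite -subr_le0].
Qed.

Lemma estimate_freq_barrier x y i : X x -> Sc y ->
  `|freq_of y i 0| = omega_bar i -> V x <= V y.
Proof.
move=> [Vx _] Sy yi.
rewrite -lee_fin; apply: le_trans Vx _; rewrite /Vmax ge_min; apply/orP; right.
apply: (@bigmin_inf _ _ _ _ i) => //.
rewrite ge_min; move: yi; have [a0|a0] := leP 0 (freq_of y i 0).
  rewrite ger0_norm// => yi.
  by apply/orP; right; apply: ereal_inf_lbound; exists y.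
rewrite ltr0_norm// => yi.
by apply/orP; left; apply: ereal_inf_lbound; exists y => //; split=> //; rewrite -yi opprK.
Qed.

(** A point of [X] violating a frequency bound is shrunk until its worst frequency ratio equals 1.
    It then lies on a frequency barrier, so [V] has not decreased, against [lyapunov_scale]. *)
Lemma estimate_sub : X `<=` Pc `&` Sc.
Proof.
move=> x Xx; split; first by case: Xx.
apply: contrapT => nS.
have [i0 hi0] : exists i, omega_bar i < `|freq_of x i 0|.
  apply: contrapT => nex; apply: nS => i; rewrite leNgt; apply/negP => ?.
  by apply: nex; exists i.
pose j := [arg max_(j > i0) (`|freq_of x j 0| / omega_bar j)]%O.
have jmax i : `|freq_of x i 0| / omega_bar i <= `|freq_of x j 0| / omega_bar j.
  by rewrite /j; case: arg_maxP => // j' _ /(_ i isT).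
have gj1 : 1 < `|freq_of x j 0| / omega_bar j.
  by apply: lt_le_trans (jmax i0); rewrite ltr_pdivlMr// mul1r.
pose s := (`|freq_of x j 0| / omega_bar j)^-1.
have s0 : 0 < s by rewrite invr_gt0; exact: lt_trans gj1.
have s1 : s < 1 by rewrite invf_lt1//; exact: lt_trans gj1.
have fE i : freq_of (s *: x) i 0 = s * freq_of x i 0.
  by rewrite /freq_of linearZ mxE.
have x0 : x != 0.
  apply/eqP => x0; move: hi0; rewrite x0 /freq_of linear0 mxE normr0 ltNge.
  by rewrite ltW.
have : V x <= V (s *: x).
  apply: (@estimate_freq_barrier x (s *: x) j) => //.
    move=> i; rewrite fE normrM (gtr0_norm s0).
    have := jmax i; rewrite ler_pdivrMr// => h.
    rewrite /s mulrC ler_pdivrMr; last exact: lt_trans gj1.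
    by rewrite mulrC.
  rewrite fE normrM (gtr0_norm s0) /s invf_div divfK//.
  by apply/eqP => xj; move: gj1; rewrite xj mul0r ltNge ler01.
have s01 : 0 <= s <= 1 by rewrite !ltW.
have := lyapunov_scale x s01.
have : 0 < (1 - s) * dotcv x (P *m x) by rewrite mulr_gt0 ?subr_gt0 ?dotcv_P_gt0.
by move: (V x) (V (s *: x)) => a b; lra.
Qed.

Lemma dsubmx_lure_fieldE y i : dsubmx (f y) i 0
  = - ((incidence G *m line_mx G *m sin_dev G thetas y) i 0
       + damping G i * dsubmx y i 0) / inertia G i.
Proof.
apply: (mulIf (lt0r_neq0 (inertia_gt0 G i))).
rewrite divfK ?lt0r_neq0 ?inertia_gt0// mulrC -(diagf_mulE (inertia G)).
rewrite (dsubmx_lure_field G thetas y) mxE; congr (- _).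
by rewrite mxE; congr (_ + _); exact: diagf_mulE.
Qed.

(** * Rest points in the constraint set *)

Lemma sector_slope k : 0 <= delta_low k + cos (ts k) /\
  (Pc = constraint_P1 G thetas \/ 0 < delta_low k + cos (ts k)).
Proof.
have [_ s1 s2 s3] := sector.
have [eP1|nP1] := pselect (Pc = constraint_P1 G thetas).
  by rewrite (s1 eP1 k) addNr; split; [|left].
suff pos : 0 < delta_low k + cos (ts k) by split; [exact: ltW|right].
have [eP2|nP2] := pselect (Pc = constraint_P2 G thetas).
  rewrite (s2 eP2 k) subrK; have tk := thetas_lt k.
  rewrite divr_gt0 ?subr_gt0// -sin_pihalf ltr_sin ?in_itv//=.
    by have := normr_ge0 (ts k); have := pi_ge0 R; move=> h1 h2; apply/andP; split; lra.
  by have := pi_ge0 R; move=> h1; apply/andP; split; lra.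
by have [v /andP[v0 _] ->] := s3 nP1 nP2 k; rewrite subrK.
Qed.

Lemma sector_sin_dev y k : Pc y ->
  (delta_low k + cos (ts k)) * dev y k ^+ 2 <= dev y k * sin_dev G thetas y k 0.
Proof.
move=> Py; rewrite mxE; have [sb _ _ _] := sector.
have [->|z0] := eqVneq (dev y k) 0; first by rewrite expr0n/= !(mulr0, mul0r).
have := sb k y Py; rewrite lure_CE => /(_ z0) /andP[lo _].
have := ler_wpM2r (sqr_ge0 (dev y k)) lo.
have -> : phi G thetas k (dev y k) / dev y k * dev y k ^+ 2 = phi G thetas k (dev y k) * dev y k.
  by rewrite expr2 mulrA divfK.
by rewrite /phi; move: (sin _) (cos _) => u v h; lra.
Qed.

(** At a rest point the torque deviation vanishes. Paired with the angle deviations it is a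
    positively weighted sum of these products, each nonnegative by the sector bound. *)
Lemma rest_point_sin_dev y : f y = 0 -> Pc y ->
  forall k, dev y k * sin_dev G thetas y k 0 = 0.
Proof.
move=> fy0 Py.
have w0 : dsubmx y = 0 by rewrite -(usubmx_lure_field G thetas) fy0 linear0.
have tq0 : incidence G *m line_mx G *m sin_dev G thetas y = 0.
  have := dsubmx_lure_field G thetas y.
  by rewrite fy0 w0 linear0 !mulmx0 addr0 => /esym/eqP; rewrite oppr_eq0 => /eqP.
have pos k : 0 <= line_coef G k * (dev y k * sin_dev G thetas y k 0).
  rewrite mulr_ge0 ?(ltW (line_coef_gt0 G k))//.
  apply: le_trans (sector_sin_dev k Py); rewrite mulr_ge0 ?sqr_ge0//.
  by have [] := sector_slope k.
have sum0 : \sum_k line_coef G k * (dev y k * sin_dev G thetas y k 0) = 0.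
  transitivity (dotcv ((incidence G)^T *m usubmx y) (line_mx G *m sin_dev G thetas y)).
    rewrite dotcv_diagf; apply: eq_bigr => k _; congr (_ * (_ * _)).
    by rewrite incidence_trE.
  by rewrite dotcv_mull trmxK mulmxA tq0 /dotcv mulmx0 mxE.
move=> k; have /eqP : line_coef G k * (dev y k * sin_dev G thetas y k 0) = 0.
  exact: (psumr_eq0P (fun i _ => pos i) sum0).
by rewrite mulf_eq0 gt_eqF ?line_coef_gt0//= => /eqP.
Qed.

(* At a nonzero rest point some angle is [pi - ts k] or [- pi - ts k], so the
   point lies on the boundary of [P_1]: pushing it outwards leaves [P_1]. *)
Lemma rest_point_boundary y : f y = 0 -> Pc y -> y != 0 ->
  Pc = constraint_P1 G thetas /\ exists k, `|ts k + dev y k| = theta_bar k.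
Proof.
move=> fy0 Py y0.
have w0 : dsubmx y = 0 by rewrite -(usubmx_lure_field G thetas) fy0 linear0.
have [k zk] : exists k, dev y k != 0.
  apply: contrapT => nex; move/eqP: y0; apply.
  rewrite -(vsubmxK y) w0 [usubmx y](@line_diff_eq0 _ _ _ G) ?col_mx0// => k.
  by apply/eqP/negP => /negP ?; apply: nex; exists k.
have sk : sin_dev G thetas y k 0 = 0.
  by have /eqP := rest_point_sin_dev fy0 Py k; rewrite mulf_eq0 (negbTE zk)/= => /eqP.
have eP1 : Pc = constraint_P1 G thetas.
  have [_ [//|spos]] := sector_slope k.
  have := sector_sin_dev k Py; rewrite sk mulr0 leNgt mulr_gt0// ?exprn_even_gt0//.
split => //; apply: contrapT => nex.
have strict j : `|ts j + dev y j| < theta_bar j.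
  rewrite lt_neqAle ((constraint_PE y).1 Py j) andbT; apply/negP => /eqP ?.
  by apply: nex; exists j.
(* With no line at its bound, [y] can be pushed slightly outwards, which makes the bounds of [P_1]
   strict on the side of the sign of [z]. *)
have [e e0 He] : exists2 e, 0 < e & Pc ((1 + e) *: y).
  have : \forall s \near (0 : R), forall j, `|ts j + (1 + s) * dev y j| < theta_bar j.
    apply: (@filter_forall _ _ (fun j (s : R) => `|ts j + (1 + s) * dev y j| < theta_bar j) (nbhs 0) _) => j.
    have c0 : `|ts j + (1 + s) * dev y j| @[s --> (0 : R)] --> `|ts j + (1 + 0) * dev y j|.
      apply: cvg_norm; apply: cvgD; first exact: cvg_cst.
      by apply: cvgM; [apply: cvgD; [exact: cvg_cst|exact: cvg_id]|exact: cvg_cst].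
    by apply: (cvgr_lt _ c0); rewrite addr0 mul1r.
  move=> /near_ball_lt[e e0 He]; exists (e / 2); first by rewrite divr_gt0.
  apply/constraint_PE => j; rewrite line_devZ; apply/ltW/He.
  by rewrite subr0 gtr0_norm ?divr_gt0//; lra.
have bnd c : Pc (c *: y) -> - pi <= ts k *+ 2 + c * dev y k <= pi.
  move=> /P_sub/(_ k); rewrite line_diff_angle line_devZ mulr2n => /andP[h1 h2].
  by apply/andP; split; lra.
have := bnd 1; rewrite scale1r mul1r => /(_ Py) /andP[b1 b2].
have := bnd _ He => /andP[b3 b4].
have tk := thetas_lt k; move: (tk); rewrite ltr_norml => /andP[t1 t2].
move: sk; rewrite mxE; set z := dev y k in zk b1 b2 b3 b4 *.
(* Neither factor vanishes: [ts k + z / 2] lies strictly between [- pi / 2] and [pi / 2], and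
   [z / 2] is nonzero of size below [pi]. *)
have -> : sin (ts k + z) - sin (ts k) = cos (ts k + z / 2) * sin (z / 2) *+ 2.
  have -> : ts k + z = (ts k + z / 2) + z / 2 by field.
  rewrite -{2}[ts k](addrK (z / 2)) sinB sinD mulr2n; ring.
move=> /eqP; rewrite mulrn_eq0/= mulf_eq0 => /orP[|].
  rewrite gt_eqF//; apply: cos_gt0_pihalf; move: e0 b1 b2 b3 b4; rewrite mulr2n mulrDl mul1r.
  have [zpos|zneg] := ltP 0 z => e0 b1 b2 b3 b4.
    have ez : 0 < e * z by exact: mulr_gt0.
    by apply/andP; split; lra.
  have ez : e * z < 0 by rewrite pmulr_rlt0// lt_neqAle zk.
  by apply/andP; split; lra.
have [zpos|zneg] := ltP 0 z.
  by rewrite gt_eqF// sin_gt0_pi//; rewrite mulr2n in b2; apply/andP; split; lra.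
have zneg' : z < 0 by rewrite lt_neqAle zk.
rewrite -oppr_eq0 -sinN gt_eqF// sin_gt0_pi//; rewrite mulr2n in b1.
by apply/andP; split; lra.
Qed.

(** A trajectory extended to negative times, so that two-sided continuity is available at 0. *)
Definition lure_flow (x : R -> 'cV[R]_(n + n)) : Prop :=
  (forall i, continuous (fun t => x t i 0)) /\
  (forall (t : R) i, 0 < t -> is_derive t 1 (fun s => x s i 0) (f (x t) i 0)).

Lemma lure_trajectory_flow (x : R -> 'cV[R]_(n + n)) : lure_trajectory G thetas x ->
  lure_flow (fun t : R => x (Num.max 0 t)).
Proof.
move=> [cx dx]; split => [i|t i t0].
  exact: (continuous_extend_left (cx i)).
rewrite (max_idPr (ltW t0)).
apply: (near_eq_is_derive _ (dx t i t0)).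
have : \forall s \near t, 0 < s by exact: lt_nbhsr.
by apply: filterS => s s0; rewrite (max_idPr (ltW s0)).
Qed.

(** * Invariance of the estimate along a trajectory *)

Section Flow.
Variable x : R -> 'cV[R]_(n + n).
Hypothesis flow : lure_flow x.

Lemma flow_cvg (t : R) i : x s i 0 @[s --> t] --> x t i 0.
Proof. by case: flow => /(_ i)/(_ t). Qed.

Lemma flow_dev_continuous k : continuous (fun t => dev (x t) k).
Proof. by move=> t; apply: (cvg_line_dev (l := x t)) => i; exact: flow_cvg. Qed.

Lemma flow_lyapunov_continuous : continuous (fun t => V (x t)).
Proof. by move=> t; apply: cvg_lyapunov => i; exact: flow_cvg. Qed.

Lemma flow_lyapunov_derive (t : R) : 0 < t ->
  is_derive t 1 (fun s => V (x s)) (DV (x t) (f (x t))).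
Proof.
move=> t0; have [Psym _] := P_posdef; apply: is_derive_lyapunov => // i.
by case: flow => _; apply.
Qed.

Lemma flow_dev_derive k (t : R) : 0 < t ->
  is_derive t 1 (fun s => dev (x s) k) (line_freq G (x t) k).
Proof.
move=> t0; rewrite -(line_dev_lure_field G thetas); apply: is_derive_line_dev => i.
by case: flow => _; apply.
Qed.

(** The 8 is the constant 4 of [norm_phi_scale] times the factor 2 in [lyapunov_diff]. *)
Definition scaling_error y : R :=
  8 * \sum_k `|((lure_B G)^T *m (P *m y)) k 0| * `|dev y k|.

Lemma scaling_error_ge0 y : 0 <= scaling_error y.
Proof. by rewrite mulr_ge0// sumr_ge0// => k _; rewrite mulr_ge0. Qed.

(* The field [f] is homogeneous of degree 1 up to an error of order [1 - s]. *)
Lemma lyapunov_decay_scale s y : 0 <= s <= 1 -> Pc (s *: y) ->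
  DV (s *: y) (s *: f y) <= (1 - s) * scaling_error y.
Proof.
move=> s01 Py; have /andP[s0 s1] := s01.
pose eta := \col_k (phi G thetas k (s * dev y k) - s * phi G thetas k (dev y k)).
have fE : s *: f y = f (s *: y) + lure_B G *m eta.
  have -> : eta = phi_vec G thetas (lure_C G *m (s *: y))
      - s *: phi_vec G thetas (lure_C G *m y).
    apply/colP => k; rewrite mxE -line_devZ -!phi_vecE.
    by rewrite [RHS]mxE [X in _ = _ + X]mxE [X in _ = _ - X]mxE.
  by rewrite /lure_field mulmxBr scalerBr -!scalemxAr addrA subrK.
have -> : DV (s *: y) (s *: f y) = DV (s *: y) (f (s *: y))
    + 2 * s * dotcv ((lure_B G)^T *m (P *m y)) eta.
  have [Psym _] := P_posdef.
  rewrite fE /lyapunov_diff mulmxDr dotcvDr.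
  have -> : dotcv (s *: y) (P *m (lure_B G *m eta))
      = s * dotcv ((lure_B G)^T *m (P *m y)) eta.
    by rewrite dotcvZl dotcv_mull trmxK dotcv_mull Psym.
  have devE k : dev (f (s *: y) + lure_B G *m eta) k = dev (f (s *: y)) k.
    by rewrite -!lure_CE mulmxDr (mulmxA (lure_C G)) lure_CB0 mul0mx addr0.
  by under eq_bigr do rewrite devE; ring.
have := lyapunov_decay_le0 Py; move=> h.
suff : 2 * s * dotcv ((lure_B G)^T *m (P *m y)) eta <= (1 - s) * scaling_error y by lra.
set w := _ *m (P *m y).
have : `|dotcv w eta| <= (1 - s) * scaling_error y / 2.
  rewrite dotcvE; apply: le_trans (ler_norm_sum _ _ _) _.
  have -> : (1 - s) * scaling_error y / 2
      = \sum_k `|w k 0| * (4 * (1 - s) * `|dev y k|).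
    transitivity (4 * (1 - s) * \sum_k `|w k 0| * `|dev y k|).
      by rewrite /scaling_error -/w; field.
    by rewrite mulr_sumr; apply: eq_bigr => k _; rewrite mulrCA.
  by apply: ler_sum => k _; rewrite normrM ler_wpM2l// mxE norm_phi_scale.
have : 2 * s * dotcv w eta <= 2 * `|dotcv w eta|.
  apply: le_trans (ler_norm _) _.
  by rewrite !normrM (ger0_norm s0) ger0_norm// -mulrA ler_pM2l// ler_piMl.
lra.
Qed.

Lemma scaling_error_continuous : continuous (fun t => scaling_error (x t)).
Proof.
move=> t; apply: cvgM; first exact: cvg_cst.
apply: cvg_sum_pt => k; apply: cvgM; apply: cvg_norm; last exact: flow_dev_continuous.
apply: (cvg_mulmx (l := P *m x t)) => i; apply: (cvg_mulmx (l := x t)) => j.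
exact: flow_cvg.
Qed.

Lemma flow_stays_locally (T : R) : 0 <= T -> X (x T) ->
  exists2 e, 0 < e & forall t, T <= t < T + e -> Pc (x t).
Proof.
have arith (a b d q r : R) : d <= a -> b <= d - q -> a - b <= r -> r < q -> False.
  by lra.
move=> T0 XT; have PT : Pc (x T) by case: XT.
(* At the origin all line constraints are strict, so continuity suffices. *)
have [xT0|xT0] := eqVneq (x T) 0.
  have : \forall t \near T, forall k, `|ts k + dev (x t) k| < theta_bar k.
    apply: (@filter_forall _ _ (fun k t => `|ts k + dev (x t) k| < theta_bar k) (nbhs T) _) => k.
    have cT : `|ts k + dev (x t) k| @[t --> T] --> `|ts k + dev (x T) k|.
      by apply: cvg_norm; apply: cvgD; [exact: cvg_cst|exact: flow_dev_continuous].
    apply: (cvgr_lt _ cT).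
    by rewrite xT0 line_dev0 addr0 theta_bar_gt.
  move=> /near_ball_lt[e e0 He]; exists e => // t /andP[Tt te].
  apply/constraint_PE => k; apply/ltW/He.
  by rewrite ger0_norm ?subr_ge0//; lra.
pose c := dotcv (x T) (P *m x T).
have c0 : 0 < c by exact: dotcv_P_gt0.
(* Near [T], [V (s *: x t)] grows at a rate of at most [(1 - s) * K]; over less than [c / K] it
   gains less than the [(1 - s) * c] lost by scaling at [T]. *)
pose K := scaling_error (x T) + 1.
have K0 : 0 < K by rewrite ltr_pwDr// scaling_error_ge0.
have : \forall t \near T, scaling_error (x t) < K.
  by apply: (cvgr_lt _ (@scaling_error_continuous T)); rewrite ltrDl.
move=> /near_ball_lt[e1 e10 He1].
exists (Num.min e1 (c / K)); first by rewrite lt_min e10 divr_gt0.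
move=> t1 /andP[]; rewrite le_eqVlt => /predU1P[<-//|Tt1 t1e].
have t1e1 : t1 - T < e1.
  by rewrite ltrBlDl; apply: lt_le_trans t1e _; rewrite lerD2l ge_min lexx.
have t1c : (t1 - T) * K < c.
  rewrite -ltr_pdivlMr// ltrBlDl; apply: lt_le_trans t1e _.
  by rewrite lerD2l ge_min lexx orbT.
apply/constraint_PE => k; rewrite leNgt; apply/negP => exitk.
(* The excess [r] over the bound at [t1] leaves room to shrink: [q] is chosen with
   [q * |d| <= r]. *)
have [s [s0 s1 exits]] : exists s, [/\ 0 < s, s < 1 &
    theta_bar k <= `|ts k + s * dev (x t1) k|].
  set d := dev (x t1) k in exitk *; set r := `|ts k + d| - theta_bar k.
  have r0 : 0 < r by rewrite subr_gt0.
  have d1 : 0 < `|d| + 1 by rewrite ltr_pwDr.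
  pose q := Num.min (1 / 2) (r / (`|d| + 1)).
  have q0 : 0 < q by rewrite lt_min divr_gt0//= divr_gt0.
  have q2 : q <= 1 / 2 by rewrite ge_min lexx.
  have qr : q * `|d| <= r.
    apply: le_trans (_ : q * (`|d| + 1) <= _); first by rewrite ler_pM2l// lerDl.
    by rewrite -ler_pdivlMr// ge_min lexx orbT.
  exists (1 - q); split; [lra|lra|].
  have : `|ts k + d| <= `|ts k + (1 - q) * d| + `|q * d|.
    apply: le_trans (ler_normD _ _).
    by rewrite (_ : ts k + (1 - q) * d + q * d = ts k + d)//; ring.
  by rewrite normrM (gtr0_norm q0) /r in qr *; lra.
pose h j t := `|ts j + s * dev (x t) j| - theta_bar j.
have hc j : continuous (h j).
  move=> t; apply: cvgB; last exact: cvg_cst.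
  apply: cvg_norm; apply: cvgD; first exact: cvg_cst.
  by apply: cvgM; [exact: cvg_cst|exact: flow_dev_continuous].
have hT j : h j T < 0.
  by rewrite subr_lt0; apply: scale_interior => //; rewrite ltW.
have ht1 : exists j, 0 <= h j t1 by exists k; rewrite subr_ge0.
have [t' [j [/andP[Tt' t't1] hj inside]]] := first_crossing (ltW Tt1) hc hT ht1.
have s01 : 0 <= s <= 1 by rewrite !ltW.
have Ps t : T <= t <= t' -> Pc (s *: x t).
  move=> Ttt'; apply/constraint_PE => i; rewrite line_devZ.
  by have := inside i t Ttt'; rewrite subr_le0.
have Pt' : Pc (s *: x t') by apply: Ps; rewrite (ltW Tt') lexx.
have yj : `|ts j + dev (s *: x t') j| = theta_bar j.
  by apply/eqP; rewrite line_devZ -subr_eq0; apply/eqP.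
(* On [[T, t']] the square of the angle difference is largest at [t'], so its derivative there is
   nonnegative; squaring covers both signs. *)
have out : 0 <= (ts j + dev (s *: x t') j) * line_freq G (s *: x t') j.
  pose u t := ts j + s * dev (x t) j.
  have cu : continuous u.
    move=> t; apply: cvgD; first exact: cvg_cst.
    by apply: cvgM; [exact: cvg_cst|exact: flow_dev_continuous].
  have cu2 : continuous (fun t => u t * u t) by move=> t; apply: cvgM; exact: cu.
  pose du t := s * line_freq G (x t) j.
  have ud (t : R) : 0 < t -> is_derive t 1 u (du t).
    move=> t0; rewrite -[du t]add0r.
    exact: (is_derive_ptD (is_derive_pt_cst (ts j) t) (is_derive_ptZ s (flow_dev_derive j t0))).
  have u2d (t : R) : 0 < t -> is_derive t 1 (fun t => u t * u t) (du t * u t + u t * du t).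
    by move=> t0; apply: is_derive_ptM; exact: ud.
  have cdu : du @ t' --> du t'.
    apply: cvgM; first exact: cvg_cst.
    rewrite -(line_dev_lure_field G thetas (x t') j).
    rewrite (_ : (fun t => _) = (fun t => dev (f (x t)) j)).
      apply: cvg_line_dev => i; apply: cvg_lure_field => i'; exact: flow_cvg.
    by apply/funext => t; rewrite line_dev_lure_field.
  have := left_max_derive_ge0 cu2 u2d _ T0 Tt' _.
  rewrite /= line_devZ line_freqZ -/(u t') -/(du t') => H.
  suff : 0 <= du t' * u t' + u t' * du t' by lra.
  apply: H.
    by apply: cvgD; apply: cvgM => //; exact: cu.
  move=> t /andP[Tt tt'].
  rewrite -!expr2 -(real_normK (num_real (u t))) -(real_normK (num_real (u t'))).
  rewrite lerXn2r ?nnegrE//.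
  have -> : `|u t'| = theta_bar j by rewrite /u -line_devZ.
  by have := inside j t; rewrite subr_le0; apply; rewrite Tt.
have barrier := estimate_line_barrier XT Pt' yj out.
have cVs : continuous (fun t => V (s *: x t)).
  move=> t; apply: cvg_lyapunov => i.
  rewrite mxE (_ : (fun t => _) = (fun t => s * x t i 0)); last first.
    by apply/funext => r; rewrite mxE.
  by apply: cvgM; [exact: cvg_cst|exact: flow_cvg].
have dVs (t : R) : 0 < t -> is_derive t 1 (fun t => V (s *: x t)) (DV (s *: x t) (s *: f (x t))).
  move=> t0; have [Psym _] := P_posdef; apply: is_derive_lyapunov => // i.
  rewrite mxE (_ : (fun t => _) = (fun t => s * x t i 0)); last first.
    by apply/funext => r; rewrite mxE.
  by apply: is_derive_ptZ; case: flow => _; apply.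
(* The barrier requires [V] to regain at least [(1 - s) * c] between [T] and [t'], more than the
   rate bound allows. *)
have [v /andP[Tv vt'] ev] := MVT_pos cVs dVs T0 Tt'.
have rate : DV (s *: x v) (s *: f (x v)) <= (1 - s) * K.
  apply: le_trans (lyapunov_decay_scale s01 (Ps v _)) _; first by rewrite !ltW.
  rewrite ler_pM2l ?subr_gt0// ltW// He1// gtr0_norm ?subr_gt0//.
  by apply: lt_trans t1e1; rewrite ltrD2r; exact: lt_le_trans t't1.
have start := lyapunov_scale (x T) s01.
rewrite -/c in start.
apply: (arith _ _ _ _ _ barrier start).
  by rewrite ev; apply: ler_wpM2r rate; rewrite subr_ge0 ltW.
rewrite -mulrA ltr_pM2l ?subr_gt0//; apply: le_lt_trans t1c.
by rewrite mulrC ler_wpM2r ?(ltW K0)// lerD2r.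
Qed.

(** Let [T] be the infimum of the times spent outside the constraint set. The set being closed,
    [x T] is still in it, and in [X] since [V] has decayed; [flow_stays_locally] then delays the
    exit beyond [T]. *)
Lemma estimate_invariant : X (x 0) -> forall t, 0 <= t -> X (x t).
Proof.
move=> X0.
have decay t : 0 <= t -> (forall s, 0 < s < t -> Pc (x s)) -> V (x t) <= V (x 0).
  move=> t0 Ps; apply: (derive_le0_nincr flow_lyapunov_continuous flow_lyapunov_derive) => //.
  by move=> s /Ps; exact: lyapunov_decay_le0.
have Xdecay t : 0 <= t -> (forall s, 0 < s < t -> Pc (x s)) -> Pc (x t) -> X (x t).
  move=> t0 Ps Pt; split => //.
  by case: X0 => + _; apply: le_trans; rewrite lee_fin decay.
suff Pall t : 0 <= t -> Pc (x t).
  move=> t t0; apply: Xdecay => //; last exact: Pall.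
  by move=> s /andP[s0 _]; apply: Pall; exact: ltW.
move=> t0; apply: contrapT => nPt.
pose S := [set s : R | 0 <= s /\ ~ Pc (x s)].
have Slb : lbound S 0 by move=> s [].
have Si : has_inf S by split; [exists t|exists 0].
pose T := inf S.
have T0 : 0 <= T by apply: lb_le_inf; [exists t|].
have before s : 0 <= s -> s < T -> Pc (x s).
  move=> s0 sT; apply: contrapT => nP.
  have : T <= s by apply: ge_inf; [exists 0|].
  by rewrite leNgt sT.
have PT : Pc (x T).
  move: (T0); rewrite le_eqVlt => /predU1P[<-|Tpos]; first by case: X0.
  apply/constraint_PE => k; rewrite leNgt; apply/negP => exitk.
  have cT : `|ts k + dev (x t) k| @[t --> T] --> `|ts k + dev (x T) k|.
    by apply: cvg_norm; apply: cvgD; [exact: cvg_cst|exact: flow_dev_continuous].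
  have : \forall t \near T, theta_bar k < `|ts k + dev (x t) k|.
    exact: (cvgr_gt _ cT _ exitk).
  move=> /near_ball_lt[e e0 He].
  pose s := Num.max 0 (T - e / 2).
  have sT : s < T by rewrite gt_max Tpos/=; lra.
  have s0 : 0 <= s by rewrite le_max lexx.
  have se : T - e / 2 <= s by rewrite le_max lexx orbT.
  have /He : `|s - T| < e by rewrite ltr_norml; apply/andP; split; lra.
  by apply/negP; rewrite -leNgt; exact: (constraint_PE _).1 (before s s0 sT) k.
have XT : X (x T).
  by apply: Xdecay => // s /andP[s0 sT]; apply: before => //; exact: ltW.
have [e e0 He] := flow_stays_locally T0 XT.
have [s Ss sT] := inf_adherent e0 Si.
case: (Ss) => _; apply; apply: He; rewrite sT andbT.
by apply: ge_inf => //; exists 0.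
Qed.

(** * Convergence of a trajectory that stays in the estimate *)

Hypothesis x_estimate : forall t, 0 <= t -> X (x t).

Lemma flow_dev_bounded k t : 0 <= t -> `|dev (x t) k| <= theta_bar k + `|ts k|.
Proof.
move=> /x_estimate[_ /constraint_PE/(_ k) b].
rewrite -[dev _ _](addKr (ts k)) addrC; apply: le_trans (ler_normB _ _) _.
by rewrite lerD2r.
Qed.

Lemma flow_freq_bounded i t : 0 <= t -> `|dsubmx (x t) i 0| <= omega_bar i.
Proof. by move=> /x_estimate/estimate_sub[_ /(_ i)]. Qed.

Lemma flow_angle_derive i (t : R) : 0 < t ->
  is_derive t 1 (fun s => usubmx (x s) i 0) (dsubmx (x t) i 0).
Proof.
move=> t0; rewrite -(usubmx_lure_field G thetas) mxE.
rewrite (_ : (fun s => _) = (fun s => x s (lshift n i) 0)); last first.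
  by apply/funext => s; rewrite mxE.
by case: flow => _; apply.
Qed.

Lemma flow_freq_derive i (t : R) : 0 < t ->
  is_derive t 1 (fun s => dsubmx (x s) i 0) (dsubmx (f (x t)) i 0).
Proof.
move=> t0; rewrite mxE.
rewrite (_ : (fun s => _) = (fun s => x s (rshift n i) 0)); last first.
  by apply/funext => s; rewrite mxE.
by case: flow => _; apply.
Qed.

Lemma flow_angle_continuous i : continuous (fun s => usubmx (x s) i 0).
Proof.
rewrite (_ : (fun s => _) = (fun s => x s (lshift n i) 0)).
  by case: flow => + _; apply.
by apply/funext => s; rewrite mxE.
Qed.

Lemma flow_freq_continuous i : continuous (fun s => dsubmx (x s) i 0).
Proof.
rewrite (_ : (fun s => _) = (fun s => x s (rshift n i) 0)).
  by case: flow => + _; apply.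
by apply/funext => s; rewrite mxE.
Qed.

Lemma flow_dev_lipschitz k s t : 0 <= s -> s <= t ->
  `|dev (x t) k - dev (x s) k|
    <= (\sum_i `|(incidence G)^T k i| * omega_bar i) * (t - s).
Proof.
apply: (derive_bounded_lipschitz (@flow_dev_continuous k) (@flow_dev_derive k)) => r r0.
rewrite /line_freq -incidence_trE; apply: norm_mulmx_le => i.
by apply: flow_freq_bounded; exact: ltW.
Qed.

(** Accelerations are bounded: sine differences are at most 2 in size, and frequencies stay within
    [omega_bar] by [estimate_sub]. *)
Lemma flow_freq_lipschitz i : exists L, forall s t, 0 <= s -> s <= t ->
  `|dsubmx (x t) i 0 - dsubmx (x s) i 0| <= L * (t - s).
Proof.
exists ((\sum_k `|(incidence G *m line_mx G) i k| * 2 + damping G i * omega_bar i) / inertia G i).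
apply: (derive_bounded_lipschitz (@flow_freq_continuous i) (@flow_freq_derive i)) => r r0.
have m0 := inertia_gt0 G i; have d0 := damping_gt0 G i.
rewrite dsubmx_lure_fieldE normrM normfV (gtr0_norm m0) normrN.
rewrite ler_pM2r ?invr_gt0//; apply: le_trans (ler_normD _ _) _; apply: lerD.
  apply: norm_mulmx_le => k; rewrite mxE; apply: le_trans (ler_normB _ _) _.
  by rewrite (_ : 2 = 1 + 1)// lerD// ler_norml sin_geN1 sin_le1.
by rewrite normrM (gtr0_norm d0) ler_pM2l// flow_freq_bounded// ltW.
Qed.

Lemma flow_lyapunov_nincr s t : 0 <= s -> s <= t -> V (x t) <= V (x s).
Proof.
move=> s0 st; apply: (derive_le0_nincr flow_lyapunov_continuous flow_lyapunov_derive) => //.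
move=> r /andP[sr _]; apply: lyapunov_decay_le0.
by have [] := x_estimate (le_trans s0 (ltW sr)).
Qed.

(* [V] is bounded below and the deviation is Lipschitz, so the sector defect
   cannot stay away from 0 on infinitely many disjoint intervals. *)
Lemma flow_dev_cvg k : exists l : R, dev (x t) k @[t --> +oo] --> l.
Proof.
apply: (avoids_cvg (@flow_dev_continuous k) (@flow_dev_bounded k)) => a b ab.
have [c cab cN0] := sector_defect_neq0 G thetas delta_low k ab.
exists c => //; pose Q z := 2 * Gamma k k * defect k z.
have G2 : 0 < 2 * Gamma k k by rewrite mulr_gt0// Gamma_gt0.
apply: (@eventually_avoids _ (fun t => V (x t)) (fun t => DV (x t) (f (x t)))
  (fun t => dev (x t) k) Q _ 0 c flow_lyapunov_continuous flow_lyapunov_derive).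
- by move=> t t0; apply: lyapunov_decay_line; have [] := x_estimate (ltW t0).
- move=> t t0; rewrite mulr_ge0 ?(ltW G2)// sector_defect_ge0//.
  by have [] := x_estimate (ltW t0).
- by move=> t _; exact: lyapunov_ge0.
- exact: flow_dev_lipschitz.
- by apply: cvgM; [exact: cvg_cst|exact: continuous_sector_defect].
- by rewrite mulf_neq0// gt_eqF.
Qed.

Lemma flow_cvg_rest_point : exists y,
  [/\ forall i, x t i 0 @[t --> +oo] --> y i 0, f y = 0, Pc y & V y <= V (x 0)].
Proof.
have [F FE] := line_diff_left_inverse G.
have /choice[l dl] := flow_dev_cvg.
pose y := col_mx (\col_i \sum_k F i k * l k) 0 : 'cV[R]_(n + n).
have thl i : usubmx (x t) i 0 @[t --> +oo] --> usubmx y i 0.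
  rewrite col_mxKu mxE.
  rewrite (_ : (fun t => _) = (fun t => \sum_k F i k * dev (x t) k)).
    by apply: cvg_sum_pt => k; apply: cvgM; [exact: cvg_cst|exact: dl].
  by apply/funext => t; rewrite FE.
(* Barbalat: the angles converge and the frequencies, their derivatives, are Lipschitz. *)
have wl i : dsubmx (x t) i 0 @[t --> +oo] --> dsubmx y i 0.
  rewrite col_mxKd mxE; have [L HL] := flow_freq_lipschitz i.
  exact: (barbalat (@flow_angle_continuous i) (thl i) (@flow_angle_derive i) HL).
have xl i : x t i 0 @[t --> +oo] --> y i 0.
  have [j ->|j ->] := split_ordP i.
    have := thl j; rewrite mxE; apply: cvg_trans; apply: near_eq_cvg.
    by apply: nearW => t; rewrite mxE.
  have := wl j; rewrite mxE; apply: cvg_trans; apply: near_eq_cvg.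
  by apply: nearW => t; rewrite mxE.
have Py : Pc y.
  apply/constraint_PE => k.
  have cl : `|ts k + dev (x t) k| @[t --> +oo] --> `|ts k + dev y k|.
    by apply: cvg_norm; apply: cvgD; [exact: cvg_cst|exact: cvg_line_dev].
  apply: (cvgr_to_le cl); exists 0; split => // t t0.
  by have [_ /constraint_PE] := x_estimate (ltW t0).
have Vl : V (x t) @[t --> +oo] --> V y by exact: cvg_lyapunov.
exists y; split; [exact: xl| |exact: Py|].
  (* The accelerations converge to those of [f y] by continuity; the frequencies converging, this
     limit is 0. *)
  rewrite -[f y]vsubmxK usubmx_lure_field col_mxKd.
  rewrite (_ : dsubmx (f y) = 0) ?col_mx0//; apply/colP => i; rewrite [RHS]mxE.
  apply: (cvg_derive_eq0 (@flow_freq_continuous i) (wl i) (@flow_freq_derive i)).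
  rewrite (_ : (fun t => _) = (fun t => f (x t) (rshift n i) 0)).
    by rewrite mxE; exact: cvg_lure_field.
  by apply/funext => t; rewrite mxE.
apply: (cvgr_to_le Vl); exists 0; split; first exact: num_real.
move=> t t0.
by apply: flow_lyapunov_nincr => //; exact: ltW.
Qed.

(** Constant [V] makes all sector defects vanish, so each line deviation avoids a dense set of
    values and is constant. The angles are then constant and the frequencies zero. *)
Lemma flow_lyapunov_cst : (forall t, 0 <= t -> V (x t) = V (x 0)) ->
  forall t, 0 <= t -> x t = x 0.
Proof.
move=> Vcst.
have DV0 t : 0 < t -> DV (x t) (f (x t)) = 0.
  move=> t0; have h1 := flow_lyapunov_derive t0.
  have h2 : is_derive t 1 (fun s => V (x s)) 0.
    apply: (near_eq_is_derive _ (is_derive_pt_cst (V (x 0)) t)).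
    have : \forall s \near t, 0 < s by exact: lt_nbhsr.
    by apply: filterS => s s0; rewrite Vcst// ltW.
  by rewrite -(@derive_val _ _ _ _ _ _ _ h1) (@derive_val _ _ _ _ _ _ _ h2).
have def0 k t : 0 < t -> defect k (dev (x t) k) = 0.
  move=> t0; have [_ Pt] := x_estimate (ltW t0).
  apply/eqP; rewrite eq_le sector_defect_ge0// andbT.
  have := lyapunov_decay_line k Pt; rewrite DV0// oppr_ge0.
  by rewrite pmulr_rle0// mulr_gt0// Gamma_gt0.
have dev_cst k : forall t, 0 <= t -> dev (x t) k = dev (x 0) k.
  apply: (avoids_cst (@flow_dev_continuous k)) => a b ab.
  have [c cab cN0] := sector_defect_neq0 G thetas delta_low k ab.
  exists c => // t t0; apply/eqP => e; move: cN0.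
  by rewrite -e def0 ?eqxx.
have u_cst t : 0 <= t -> usubmx (x t) = usubmx (x 0).
  move=> t0; have [F FE] := line_diff_left_inverse G.
  apply/colP => i; rewrite FE (FE (usubmx (x 0))); apply: eq_bigr => k _.
  by congr (_ * _); exact: dev_cst.
have w_pos t : 0 < t -> dsubmx (x t) = 0.
  move=> t0; apply/colP => i; have h1 := flow_angle_derive i t0.
  have h2 : is_derive t 1 (fun s => usubmx (x s) i 0) 0.
    apply: (near_eq_is_derive _ (is_derive_pt_cst (usubmx (x 0) i 0) t)).
    have : \forall s \near t, 0 < s by exact: lt_nbhsr.
    by apply: filterS => s s0; rewrite u_cst// ltW.
  by rewrite [RHS]mxE -(@derive_val _ _ _ _ _ _ _ h1) (@derive_val _ _ _ _ _ _ _ h2).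
(* The equation is available only at positive times; time 0 is reached by continuity. *)
have w0 : dsubmx (x 0) = 0.
  apply/colP => i; rewrite [RHS]mxE; apply/eqP/negP => /negP wN0.
  have cn : `|dsubmx (x t) i 0| @[t --> (0 : R)] --> `|dsubmx (x 0) i 0|.
    by apply: cvg_norm; exact: flow_freq_continuous.
  have : \forall t \near (0 : R), 0 < `|dsubmx (x t) i 0|.
    by apply: (cvgr_gt _ cn); rewrite normr_gt0.
  move=> /near_ball_lt[e e0 He].
  have := He (e / 2); rewrite subr0 gtr0_norm ?divr_gt0// w_pos ?divr_gt0//.
  by rewrite mxE normr0 ltxx => H; have : false by apply: H; lra.
move=> t; rewrite le_eqVlt => /predU1P[<-//|t0].
by rewrite -(vsubmxK (x t)) -(vsubmxK (x 0)) u_cst ?ltW// w_pos// w0.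
Qed.

Lemma flow_cvg0 : ~ boundary_rest_point G thetas theta_bar (x 0) ->
  forall i, x t i 0 @[t --> +oo] --> 0.
Proof.
move=> nb; have [y [xl fy Py Vy]] := flow_cvg_rest_point.
have [y0|yN0] := eqVneq y 0; first by move=> i; have := xl i; rewrite y0 mxE.
exfalso; apply: nb.
have [eP1 [k yk]] := rest_point_boundary fy Py yN0.
have w0 : dsubmx y = 0 by rewrite -(usubmx_lure_field G thetas) fy linear0.
have Vge t : 0 <= t -> V y = V (x t).
  move=> t0; apply/eqP; rewrite eq_le; apply/andP; split.
    have Vl : V (x t) @[t --> +oo] --> V y by exact: cvg_lyapunov.
    apply: (cvgr_to_le Vl); exists t; split; first exact: num_real.
    by move=> s ts; apply: flow_lyapunov_nincr => //; exact: ltW.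
  (* The limit [y] has zero frequencies, so it meets the sign condition with equality and counts as
     a barrier point. *)
  apply: (estimate_line_barrier (x_estimate t0) Py yk).
  by rewrite /line_freq w0 line_diff0 mulr0.
have cst t : 0 <= t -> x t = x 0.
  by apply: flow_lyapunov_cst => s s0; rewrite -(Vge s s0) -(Vge 0 (lexx 0)).
suff -> : x 0 = y by [].
apply/colP => i; apply/esym.
have := xl i; move=> /(@cvg_lim _ (@Rhausdorff R)) <-.
apply: lim_near_cst; first exact: Rhausdorff.
by exists 0; split => // t t0; rewrite cst// ltW.
Qed.

End Flow.

End RegionOfAttraction.

(** * The swing equation *)

Section SwingEquation.
Variables (R : realType) (n m : nat) (G : power_network R n m).
Variable thetas : 'cV[R]_n.

(** Here [p] is already replaced by the torque at [thetas], which turns the right-hand side into the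
    torque deviation of [dsubmx_lure_field]. *)
Lemma swing_lure_field (theta omega a : 'cV[R]_n) :
  inertia_mx G *m a + damping_mx G *m omega
    = electrical_torque G thetas - electrical_torque G theta ->
  lure_field G thetas (state thetas theta omega) = col_mx omega a.
Proof.
move=> eqn; rewrite -[LHS]vsubmxK usubmx_lure_field col_mxKd; congr col_mx.
have Mu : inertia_mx G \in unitmx by apply: diagf_unitmx; exact: inertia_gt0.
apply: (can_inj (mulKmx Mu)); rewrite dsubmx_lure_field col_mxKd.
have -> : incidence G *m line_mx G *m sin_dev G thetas (state thetas theta omega)
    = electrical_torque G theta - electrical_torque G thetas.
  rewrite /electrical_torque -mulmxBr; congr (_ *m _); apply/colP => k.
  have sinE v : map_mx sin ((incidence G)^T *m v) k 0 = sin (line_diff G v k).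
    by rewrite mxE incidence_trE.
  rewrite [RHS]mxE [X in _ = _ + X]mxE !sinE mxE /line_dev col_mxKu.
  by rewrite -line_diffD (addrC thetas) subrK.
by rewrite opprD opprB -eqn addrK.
Qed.

Lemma swing_lure_trajectory (theta omega : R -> 'cV[R]_n) :
  swing_trajectory G (electrical_torque G thetas) theta omega ->
  lure_trajectory G thetas (fun t => state thetas (theta t) (omega t)).
Proof.
move=> [ct co dt dw]; split => [i|t i t0].
  have [j ->|j ->] := split_ordP i.
    rewrite (_ : (fun t => _) = (fun t => theta t j 0 - thetas j 0)).
      by move=> z; apply: cvgB; [exact: ct|exact: cvg_cst].
    by apply/funext => t; rewrite col_mxEu !mxE.
  rewrite (_ : (fun t => _) = (fun t => omega t j 0)); first exact: co.
  by apply/funext => t; rewrite col_mxEd.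
have [dom eqn] := dw t t0; rewrite (swing_lure_field eqn).
have [j ->|j ->] := split_ordP i.
  rewrite (_ : (fun t => _) = (fun t => theta t j 0 + - thetas j 0)).
    rewrite col_mxEu -[omega t j 0]addr0.
    exact: (is_derive_ptD (dt t j t0) (is_derive_pt_cst _ t)).
  by apply/funext => s; rewrite col_mxEu !mxE.
rewrite (_ : (fun t => _) = (fun t => omega t j 0)); last first.
  by apply/funext => s; rewrite col_mxEd.
by rewrite col_mxEd mxE derive1E; exact: DeriveDef.
Qed.

End SwingEquation.

Theorem theorem1 (R : realType) (n m : nat) (G : power_network R n m)
    (p thetas : 'cV[R]_n) (theta_bar : 'I_m -> R) (omega_bar : 'I_n -> R)
    (delta_low : 'I_m -> R)
    (P : 'M[R]_(n + n)) (lambda : 'I_m -> R) (Gamma : 'M[R]_m)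
    (p_eq : p = electrical_torque G thetas)
    (thetas_lt : forall k, `|line_diff G thetas k| < pi / 2)
    (P2_sub : constraint_P2 G thetas `<=` constraint_P G thetas theta_bar)
    (P_sub : constraint_P G thetas theta_bar `<=` constraint_P1 G thetas)
    (omega_bar_gt0 : forall i, 0 < omega_bar i)
    (sector : sector_bounds G thetas theta_bar delta_low)
    (P_posdef : posdefmx P)
    (lambda_ge0 : forall k, 0 <= lambda k)
    (Gamma_diag : is_diag_mx Gamma)
    (Gamma_posdef : posdefmx Gamma)
    (R_le0 : le_semidef (lmi_R G thetas delta_low P lambda Gamma) 0) :
  let V := lyapunov G thetas P lambda in
  let X := roa_estimate G thetas V theta_bar omega_bar in
  [/\ invariant_set G thetas X,
      X `<=` constraint_P G thetas theta_bar `&` constraint_S omega_bar,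
      forall x : R -> 'cV[R]_(n + n),
        lure_trajectory G thetas x -> X (x 0) ->
        ~ boundary_rest_point G thetas theta_bar (x 0) ->
        x t @[t --> +oo] --> (0 : 'cV[R]_(n + n)) &
      forall theta omega : R -> 'cV[R]_n,
        swing_trajectory G p theta omega ->
        X (state thetas (theta 0) (omega 0)) ->
        ~ boundary_rest_point G thetas theta_bar (state thetas (theta 0) (omega 0)) ->
        state thetas (theta t) (omega t) @[t --> +oo] --> (0 : 'cV[R]_(n + n))].
Proof.
move=> V X.
have inv (x : R -> 'cV[R]_(n + n)) : lure_trajectory G thetas x -> X (x 0) ->
    forall t, 0 <= t -> X (x (Num.max 0 t)).
  move=> /lure_trajectory_flow flow X0; have X0' : X (x (Num.max 0 0)) by rewrite maxxx.
  move=> t; exact: (estimate_invariant thetas_lt P2_sub sector P_posdef lambda_ge0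
    Gamma_diag Gamma_posdef R_le0 flow X0').
have cvg0 (x : R -> 'cV[R]_(n + n)) : lure_trajectory G thetas x -> X (x 0) ->
    ~ boundary_rest_point G thetas theta_bar (x 0) ->
    x t @[t --> +oo] --> (0 : 'cV[R]_(n + n)).
  move=> traj X0 nb; apply: cvg_colP => i; rewrite mxE.
  have nb' : ~ boundary_rest_point G thetas theta_bar (x (Num.max 0 0)) by rewrite maxxx.
  have xl : x (Num.max 0 t) i 0 @[t --> +oo] --> 0.
    exact: (flow_cvg0 thetas_lt P2_sub P_sub omega_bar_gt0 sector P_posdef lambda_ge0
      Gamma_diag Gamma_posdef R_le0 (lure_trajectory_flow traj) (inv x traj X0) nb').
  apply: cvg_trans xl; apply: near_eq_cvg; exists 0; split; first exact: num_real.
  by move=> t t0; rewrite (max_idPr (ltW t0)).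
split=> [x traj X0 t t0||//|theta omega].
- by have := inv x traj X0 t t0; rewrite (max_idPr t0).
- exact: estimate_sub.
- by rewrite p_eq => /swing_lure_trajectory; exact: cvg0.
Qed.
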